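(* Let $N<0$ and let $\alpha\in\mathbb{C}$ be arbitrary. Then along either vertical direction $\arg s=\pm\pi/2$, with $r=|s|$, $$\big|\phi(s)z^{-s}\big|=\exp\!\Big(\tfrac{|N|}{2\tau}\,r^{2}\ln r\,(1+o(1))\Big)\longrightarrow\infty\qquad(r\to\infty),$$ so no contour $\gamma=L_{\theta^-,\theta^+}$ with $\theta^+$ or $-\theta^-$ in $(\pi/4,3\pi/4)$ satisfies the absolute-convergence condition $\int_\gamma|\phi(s)z^{-s}||ds|<\infty$. In particular no straight line $c+i\mathbb{R}$ is admissible, and there is no strip in which $\phi$ is recovered from a function by the classical Mellin inversion formula along a vertical line.
   Context: For $\tau>0$, $G(z;\tau)$ is the Barnes double gamma function: the entire function $G(z;\tau)=\frac{z}{\tau}e^{c_1 z/\tau+c_2 z^2/(2\tau^2)}\prod_{(k,l)\in\mathbb{Z}_{\ge0}^2\setminus\{(0,0)\}}\big(1+\frac{z}{k\tau+l}\big)e^{-\frac{z}{k\tau+l}+\frac{z^2}{2(k\tau+l)^2}}$, with real constants $c_1,c_2$ (depending on $\tau$) uniquely determined by $G(z+1;\tau)=\Gamma(z/\tau)G(z;\tau)$ and $G(z+\tau;\tau)=(2\pi)^{(\tau-1)/2}\tau^{1/2-z}\Gamma(z)G(z;\tau)$. Let $\tau>0$, $0\le m\le q$, $0\le n\le p$ integers, $\mathbf a\in\mathbb{C}^p$, $\mathbf b\in\mathbb{C}^q$, $\alpha\in\mathbb{C}$. Put $$\mathcal G(s)=\frac{\prod_{j=1}^{m}G(b_j-s;\tau)\prod_{j=1}^{n}G(1+\tau-a_j+s;\tau)}{\prod_{j=m+1}^{q}G(1+\tau-b_j+s;\tau)\prod_{j=n+1}^{p}G(a_j-s;\tau)},\quad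 \phi(s)=\mathcal G(s)e^{\pi\alpha s^2/\tau},\quad N=2(m+n)-p-q,$$ $\Lambda^+=\{a_j+l\tau+k: n<j\le p,\ l,k\in\mathbb{Z}_{\ge0}\}$, $\Lambda^-=\{b_j-l\tau-k: m<j\le q,\ l,k\in\mathbb{Z}_{\ge1}\}$, $P=\Lambda^+\cup\Lambda^-$; it is assumed throughout that $\max_{m<j\le q}\operatorname{Re}b_j-\tau-1<\min_{n<j\le p}\operatorname{Re}a_j$ (with value $-\infty$ on the left if $m=q$, $+\infty$ on the right if $n=p$). $z$ is a point of the Riemann surface of the logarithm and $z^{-s}=e^{-s\log z}$. A contour $\gamma=L_{\theta^-,\theta^+}$ is admissible if: (A1) it is a simple, piecewise smooth, proper curve $\mathbb{R}\to\mathbb{C}\setminus P$; (A2) outside some disc it coincides with two straight rays of angles $\theta^-\in(-\pi,0)$ and $\theta^+\in(0,\pi)$, and is traversed from the $\theta^-$ end to the $\theta^+$ end; (A3) $\mathbb{C}\setminus\gamma$ has two components, $\Lambda^+$ lies in the one containing the large positive reals and $\Lambda^-$ in the other; (A4) $\int_\gamma|\phi(s)z^{-s}||ds|<\infty$. *)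

(* Defs.v *)
From HB Require Import structures.
From mathcomp Require Import all_boot all_order all_algebra.
From mathcomp Require Import complex.
From mathcomp Require Import all_classical all_reals all_analysis.
Set Implicit Arguments.
Unset Strict Implicit.
Unset Printing Implicit Defensive.
Import Order.TTheory GRing.Theory Num.Theory.
Import numFieldNormedType.Exports.
Local Open Scope classical_set_scope.
Local Open Scope ring_scope.
Local Open Scope complex_scope.

(* The complex numbers are [R[i]]; the library puts its topology on the alias
   [R[i]^o], so topological notions are taken through that alias.  The real
   modulus is [Normc.normc], since [`|z|] has values in [R[i]]. *)
Definition modulus (R : realType) (z : R[i]) : R := Normc.normc z.

Definition clim (R : realType) (u : nat -> R[i]) : R[i] :=
  limn (u : nat -> R[i]^o).

Definition polar (R : realType) (r theta : R) : R[i] :=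
  (r * cos theta) +i* (r * sin theta).

Definition cexp (R : realType) (z : R[i]) : R[i] :=
  polar (expR (complex.Re z)) (complex.Im z).

(* Gauss's limit n! n^z / (z (z+1) ... (z+n)) *)
Definition cGamma (R : realType) (z : R[i]) : R[i] :=
  clim (fun n : nat => n`!%:R * cexp (z * (ln (n%:R : R))%:C)
                       / \prod_(k < n.+1) (z + k%:R)).

Definition Gamma_pole (R : realType) (z : R[i]) : Prop :=
  exists k : nat, z = - k%:R.

Definition barnes_factor (R : realType) (tau : R) (k l : nat) (z : R[i])
    : R[i] :=
  let w := (k%:R * tau + l%:R)%:C in
  (1 + z / w) * cexp (- (z / w) + z ^+ 2 / (2 * w ^+ 2)).

(* For [0 < tau] the double product converges absolutely; here it is the limit
   of the partial products over the squares [0 <= k, l < n]. *)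
Definition barnes_product (R : realType) (tau : R) (z : R[i]) : R[i] :=
  clim (fun n : nat => \prod_(k < n) \prod_(l < n | (0 < k + l)%N)
                         barnes_factor tau k l z).

Definition barnes_form (R : realType) (tau : R) (c : R * R) (z : R[i])
    : R[i] :=
  z / tau%:C
  * cexp (c.1%:C * z / tau%:C + c.2%:C * z ^+ 2 / (2 * tau%:C ^+ 2))
  * barnes_product tau z.

(* The functional equations are required where the Gamma factor is finite. *)
Definition barnes_equations (R : realType) (tau : R) (G : R[i] -> R[i])
    : Prop :=
  (forall z, ~ Gamma_pole (z / tau%:C) ->
     G (z + 1) = cGamma (z / tau%:C) * G z) /\
  (forall z, ~ Gamma_pole z ->
     G (z + tau%:C) = ((2 * pi) `^ ((tau - 1) / 2))%:C
                      * cexp ((2^-1 - z) * (ln tau)%:C) * cGamma z * G z).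

(* The pair (c_1, c_2) is unique, so [xget] picks it; the default value (0, 0)
   only makes the definition total. *)
Definition barnes_constants (R : realType) (tau : R) : R * R :=
  xget (0, 0) [set c : R * R | barnes_equations tau (barnes_form tau c)].

Definition barnesG (R : realType) (tau : R) : R[i] -> R[i] :=
  barnes_form tau (barnes_constants tau).

(* Families are indexed from 0: [a j], [b j] stand for a_(j+1), b_(j+1). *)
Definition calG (R : realType) (tau : R) (m n p q : nat)
    (a : 'I_p -> R[i]) (b : 'I_q -> R[i]) (s : R[i]) : R[i] :=
  ((\prod_(j < q | (j < m)%N) barnesG tau (b j - s))
   * (\prod_(j < p | (j < n)%N) barnesG tau (1 + tau%:C - a j + s)))
  / ((\prod_(j < q | (m <= j)%N) barnesG tau (1 + tau%:C - b j + s))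
     * (\prod_(j < p | (n <= j)%N) barnesG tau (a j - s))).

Definition phi (R : realType) (tau : R) (m n p q : nat)
    (a : 'I_p -> R[i]) (b : 'I_q -> R[i]) (alpha s : R[i]) : R[i] :=
  calG tau m n a b s * cexp (pi%:C * alpha * s ^+ 2 / tau%:C).

Definition indexN (m n p q : nat) : int := (2 * (m + n))%:Z - p%:Z - q%:Z.

Definition Lambda_plus (R : realType) (tau : R) (n p : nat)
    (a : 'I_p -> R[i]) : set R[i] :=
  [set s | exists (j : 'I_p) (l k : nat),
     (n <= j)%N /\ s = a j + l%:R * tau%:C + k%:R].

Definition Lambda_minus (R : realType) (tau : R) (m q : nat)
    (b : 'I_q -> R[i]) : set R[i] :=
  [set s | exists (j : 'I_q) (l k : nat),
     [/\ (m <= j)%N, (1 <= l)%N, (1 <= k)%N &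
         s = b j - l%:R * tau%:C - k%:R]].

Definition poles (R : realType) (tau : R) (m n p q : nat)
    (a : 'I_p -> R[i]) (b : 'I_q -> R[i]) : set R[i] :=
  Lambda_plus tau n a `|` Lambda_minus tau m b.

Definition pole_gap (R : realType) (tau : R) (m n p q : nat)
    (a : 'I_p -> R[i]) (b : 'I_q -> R[i]) : Prop :=
  (\big[maxe/-oo]_(j < q | (m <= j)%N) (complex.Re (b j))%:E
     - tau%:E - 1%:E
   < \big[mine/+oo]_(j < p | (n <= j)%N) (complex.Re (a j))%:E)%E.

(* log z for the point z of modulus [rho] and argument [omega] on the Riemann
   surface of the logarithm; [omega] is not reduced modulo 2 pi. *)
Definition log_point (R : realType) (rho omega : R) : R[i] :=
  (ln rho) +i* omega.

(* phi(s) z^(-s), with [logz] the logarithm of z *)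
Definition twisted (R : realType) (F : R[i] -> R[i]) (logz s : R[i]) : R[i] :=
  F s * cexp (- s * logz).

Definition C1 (R : realType) (f : R -> R) : Prop :=
  (forall x, derivable f x 1) /\ continuous (derive1 f).

Definition C1_on (R : realType) (u v : R) (gamma : R -> R[i]) : Prop :=
  exists g : R -> R[i],
    [/\ C1 (fun t => complex.Re (g t)), C1 (fun t => complex.Im (g t)) &
        forall t, u <= t <= v -> gamma t = g t].

(* "Piecewise smooth" is taken in its weakest sense: each compact interval has
   a finite subdivision into closed pieces on which the curve is C^1. *)
Definition piecewise_smooth (R : realType) (gamma : R -> R[i]) : Prop :=
  forall u v : R, u < v ->
    exists (k : nat) (t : nat -> R),
      [/\ t 0%N = u, t k = v &
          forall i, (i < k)%N ->
            t i < t i.+1 /\ C1_on (t i) (t i.+1) gamma].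

Definition speed (R : realType) (gamma : R -> R[i]) (t : R) : R :=
  modulus (derive1 (fun t => complex.Re (gamma t)) t
           +i* derive1 (fun t => complex.Im (gamma t)) t).

Definition proper_curve (R : realType) (gamma : R -> R[i]) : Prop :=
  continuous (gamma : R -> R[i]^o) /\
  forall K : set R[i], compact (K : set R[i]^o) ->
    compact (gamma @^-1` K).

Definition condA1 (R : realType) (P : set R[i]) (gamma : R -> R[i]) : Prop :=
  [/\ injective gamma, piecewise_smooth gamma, proper_curve gamma &
      forall t, ~ P (gamma t)].

Definition ray (R : realType) (w : R[i]) (theta : R) : set R[i] :=
  [set s | exists r : R, 0 <= r /\ s = w + polar r theta].

Definition condA2 (R : realType) (gamma : R -> R[i]) (thm thp : R) : Prop :=
  [/\ - pi < thm < 0, 0 < thp < pi &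
   exists (center wm wp : R[i]) (rho : R),
   [/\ forall s, rho < modulus (s - center) ->
         (range gamma s <-> ray wm thm s \/ ray wp thp s),
       \forall t \near -oo, ray wm thm (gamma t) &
       \forall t \near +oo, ray wp thp (gamma t)]].

Definition components (R : realType) (A : set R[i]) : set (set R[i]) :=
  [set connected_component (A : set R[i]^o) x | x in A].

Definition condA3 (R : realType) (Lp Lm : set R[i]) (gamma : R -> R[i])
    : Prop :=
  exists U V : set R[i],
    [/\ U <> V, components (~` range gamma) = [set U; V],
        (exists M : R, forall x : R, M < x -> U x%:C),
        Lp `<=` U & Lm `<=` V].

Definition condA4 (R : realType) (F : R[i] -> R[i]) (logz : R[i])
    (gamma : R -> R[i]) : Prop :=
  (\int[lebesgue_measure]_t
     (modulus (twisted F logz (gamma t)) * speed gamma t)%:E < +oo)%E.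

Definition admissible (R : realType) (tau : R) (m n p q : nat)
    (a : 'I_p -> R[i]) (b : 'I_q -> R[i]) (alpha logz : R[i])
    (gamma : R -> R[i]) (thm thp : R) : Prop :=
  [/\ condA1 (poles tau m n a b) gamma,
      condA2 gamma thm thp,
      condA3 (Lambda_plus tau n a) (Lambda_minus tau m b) gamma &
      condA4 (phi tau m n a b alpha) logz gamma].

Definition vertical_line (R : realType) (c : R) : set R[i] :=
  [set s | complex.Re s = c].

Definition cintegrable (R : realType) (D : set R) (g : R -> R[i]) : Prop :=
  lebesgue_measure.-integrable D (fun x => (complex.Re (g x))%:E) /\
  lebesgue_measure.-integrable D (fun x => (complex.Im (g x))%:E).

Definition cintegral (R : realType) (D : set R) (g : R -> R[i]) : R[i] :=
  (\int[lebesgue_measure]_(x in D) complex.Re (g x))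
  +i* (\int[lebesgue_measure]_(x in D) complex.Im (g x)).

(* The integral of f(x) x^(s-1) over (0, oo) converges absolutely, to v. *)
Definition is_mellin_transform (R : realType) (f : R -> R[i]) (s v : R[i])
    : Prop :=
  let g x := f x * cexp ((s - 1) * (ln x)%:C) in
  cintegrable `]0, +oo[ g /\ v = cintegral `]0, +oo[ g.

(* (2 pi i)^-1 times the integral of F(s) x^(-s) ds along Re s = c converges
   absolutely, to v; with s = c + i t, ds = i dt. *)
Definition is_inverse_mellin (R : realType) (F : R[i] -> R[i]) (c x : R)
    (v : R[i]) : Prop :=
  let g t := twisted F (ln x)%:C (c +i* t) in
  cintegrable setT g /\ v = ((2 * pi)^-1)%:C * cintegral setT g.

(* Main.v *)
Require Import Defs.
From HB Require Import structures.
From mathcomp Require Import all_boot all_order all_algebra.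
From mathcomp Require Import complex.
From mathcomp Require Import all_classical all_reals all_analysis.
From mathcomp Require Import measurable_realfun.
From mathcomp Require Import ring lra.
Import Order.TTheory GRing.Theory Num.Theory.
Import numFieldNormedType.Exports.
Local Open Scope classical_set_scope.
Local Open Scope ring_scope.
Local Open Scope complex_scope.

(** In a cone [|Im s| >= |s| / 2] every factor
    [s |-> G (w + s; tau)], and equally [s |-> G (w - s; tau)], satisfies
    [ln |G| = Re (s^2) / (2 tau) * ln |s| + O(|s|^2)].  Multiplying these
    estimates, [ln |phi s z^(-s)|] is [N Re (s^2) / (2 tau) * ln |s|], up to
    [O(|s|^2)]: the Gaussian factor [exp (pi alpha s^2 / tau)], the power
    [z^(-s)] and the exponential factor of [G] all disappear in the error, so
    that neither [alpha] nor the constants [c_1], [c_2] matter.  Where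
    [Re (s^2)] is negative and comparable to [|s|^2], and [N < 0], the modulus
    therefore grows like [exp (const * |s|^2 ln |s|)].

    The estimate for [G] comes from its product over the lattice points
    [w = k tau + l].  With [u = z / w], the logarithm of the modulus of one
    factor is [ln |1 + u| - Re u + Re (z^2) / (2 w^2)].  Over the square
    [k, l < M] with [M] comparable to [|z|], the terms [ln |1 + u| - Re u] add
    up to [O(|z|^2)] -- here [|Im z|] must be comparable to [|z|], to keep
    [|1 + u|] from being small -- and the sum of [1 / w^2] is
    [(ln M) / tau + O(1)] (lemmas [shell_sum_near], [shell_sum_inv_sqr]).
    Outside the square each factor is [1 + O(|u|^3)], which gives the
    convergence of the product and one more [O(|z|^2)] (lemmas
    [weierstrass_factor_sub1], [shell_sum_far]).  The result is
    [barnesG_estimate], and [log_growth_twisted] for [phi s z^(-s)].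

    Along a proper curve ending on a ray whose angle [theta] satisfies
    [cos (2 theta) < 0], the integrand is eventually at least the speed of the
    curve; as the curve runs to infinity, its length is infinite
    ([ray_end_diverges]).  A curve whose image is a vertical line has vertical
    end rays.  Finally, a Mellin transform is bounded along a vertical line
    ([mellin_transform_bounded]), and an integrable function cannot stay away
    from 0 on a half-line ([cintegrable_not_large]); both contradict the growth
    of [phi]. *)

(** * The modulus of complex numbers and the Weierstrass factor *)

Section Modulus.
Context {R : realType}.
Implicit Types z w : R[i].

Lemma modulusE z : modulus z = Num.sqrt (complex.Re z ^+ 2 + complex.Im z ^+ 2).
Proof. by case: z. Qed.

Lemma modulus_ge0 z : 0 <= modulus z.
Proof. by rewrite modulusE sqrtr_ge0. Qed.

Lemma sqr_modulus z : modulus z ^+ 2 = complex.Re z ^+ 2 + complex.Im z ^+ 2.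
Proof. by rewrite modulusE sqr_sqrtr// addr_ge0// sqr_ge0. Qed.

Lemma modulusM z w : modulus (z * w) = modulus z * modulus w.
Proof. exact: Normc.normcM. Qed.

Lemma modulusV z : modulus z^-1 = (modulus z)^-1.
Proof. exact: Normc.normcV. Qed.

Lemma modulus1 : modulus (1 : R[i]) = 1.
Proof. exact: Normc.normc1. Qed.

Lemma modulusN z : modulus (- z) = modulus z.
Proof. exact: normcN. Qed.

Lemma modulusD_le z w : modulus (z + w) <= modulus z + modulus w.
Proof. exact: le_normcD. Qed.

Lemma modulus_prod (I : Type) (r : seq I) (P : pred I) (F : I -> R[i]) :
  modulus (\prod_(i <- r | P i) F i) = \prod_(i <- r | P i) modulus (F i).
Proof. by rewrite (big_morph _ modulusM modulus1). Qed.

Lemma modulus_real (x : R) : modulus x%:C = `|x|.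
Proof. by rewrite modulusE /= expr0n /= addr0 sqrtr_sqr. Qed.

Lemma modulus_polar (r theta : R) : 0 <= r -> modulus (polar r theta) = r.
Proof.
move=> r0; rewrite modulusE /= !exprMn -mulrDr cos2Dsin2 mulr1 sqrtr_sqr.
by rewrite ger0_norm.
Qed.

Lemma modulus_cexp z : modulus (cexp z) = expR (complex.Re z).
Proof. by rewrite modulus_polar// expR_ge0. Qed.

Lemma Re_le_modulus z : `|complex.Re z| <= modulus z.
Proof. by rewrite -sqrtr_sqr modulusE ler_sqrt ?addr_ge0 ?sqr_ge0// lerDl sqr_ge0. Qed.

Lemma Im_le_modulus z : `|complex.Im z| <= modulus z.
Proof. by rewrite -sqrtr_sqr modulusE ler_sqrt ?addr_ge0 ?sqr_ge0// lerDr sqr_ge0. Qed.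

Lemma modulus_le_ReIm z : modulus z <= `|complex.Re z| + `|complex.Im z|.
Proof.
rewrite -(@ler_pXn2r _ 2) ?nnegrE ?modulus_ge0 ?addr_ge0//.
rewrite sqr_modulus sqrrD !real_normK ?num_real// -addrA lerD2l lerDr.
by rewrite mulrn_wge0// mulr_ge0.
Qed.

Lemma ReD z w : complex.Re (z + w) = complex.Re z + complex.Re w.
Proof. by case: z; case: w. Qed.

Lemma ImD z w : complex.Im (z + w) = complex.Im z + complex.Im w.
Proof. by case: z; case: w. Qed.

Lemma ReN z : complex.Re (- z) = - complex.Re z.
Proof. by case: z. Qed.

Lemma ImN z : complex.Im (- z) = - complex.Im z.
Proof. by case: z. Qed.

Lemma Re_sqr z : complex.Re (z ^+ 2) = complex.Re z ^+ 2 - complex.Im z ^+ 2.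
Proof. by case: z => x y; rewrite !expr2. Qed.

Lemma divc_real z (x : R) : x != 0 ->
  z / x%:C = (complex.Re z / x) +i* (complex.Im z / x).
Proof.
move=> x0; have xC0 : x%:C != 0 by rewrite eq_complex /= eqxx andbT.
apply: (mulIf xC0); rewrite divfK//; case: z => a b.
by apply/eqP; rewrite eq_complex /= !mulr0 subr0 add0r !divfK ?eqxx.
Qed.

Lemma ReM_real z (x : R) : complex.Re (z * x%:C) = complex.Re z * x.
Proof. by case: z => a b /=; rewrite mulr0 subr0. Qed.

End Modulus.

Section WeierstrassFactor.
Context {R : realType}.

Lemma increment_le (f df : R -> R) (K : R) :
  (forall t : R, is_derive t 1 f (df t)) ->
  (forall t : R, 0 <= t <= 1 -> `|df t| <= K) -> `|f 1 - f 0| <= K.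
Proof.
move=> fdf dfK.
have fc : {within `[0, 1], continuous f}.
  apply: continuous_subspaceT => x; apply: differentiable_continuous.
  by apply/derivable1_diffP; exact: (@ex_derive _ _ _ _ _ _ _ (fdf x)).
have [t t01 ->] := MVT ltr01 (fun t _ => fdf t) fc.
rewrite subr0 mulr1; apply: dfK; move: t01; rewrite in_itv /= => /andP[? ?].
by rewrite !ltW.
Qed.

(** The path [t |-> (1 + t u) exp (- t u + (t u)^2 / 2)], for [u = a + i b],
    joins 1 to the Weierstrass factor of genus 2, and has derivative
    [t^2 u^3 exp (- t u + (t u)^2 / 2)].  Below, [X] and [Y] are the real and
    imaginary parts of the exponent, [f] and [g] those of the path, [p] and [q]
    those of [u^3]. *)
Section Path.
Variables a b : R.
Let X (t : R) : R := - (t * a) + t ^+ 2 * ((a ^+ 2 - b ^+ 2) / 2).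
Let Y (t : R) : R := - (t * b) + t ^+ 2 * (a * b).

Let dX (t : R) : is_derive t 1 X (- a + 2 * t * ((a ^+ 2 - b ^+ 2) / 2)).
Proof.
rewrite /X; apply: is_derive_eq.
by rewrite /GRing.scale /=; ring.
Qed.

Let dY (t : R) : is_derive t 1 Y (- b + 2 * t * (a * b)).
Proof.
rewrite /Y; apply: is_derive_eq.
by rewrite /GRing.scale /=; ring.
Qed.

Let dE (t : R) : is_derive t 1 (fun t => expR (X t))
  (expR (X t) * (- a + 2 * t * ((a ^+ 2 - b ^+ 2) / 2))).
Proof. exact: (is_derive1_comp (is_derive_expR _) (dX t)). Qed.

Let dS (t : R) : is_derive t 1 (fun t => sin (Y t))
  (cos (Y t) * (- b + 2 * t * (a * b))).
Proof. exact: (is_derive1_comp (is_derive_sin _) (dY t)). Qed.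

Let dC (t : R) : is_derive t 1 (fun t => cos (Y t))
  (- sin (Y t) * (- b + 2 * t * (a * b))).
Proof. exact: (is_derive1_comp (is_derive_cos _) (dY t)). Qed.

Let f (t : R) : R := expR (X t) * ((1 + t * a) * cos (Y t) - t * b * sin (Y t)).
Let g (t : R) : R := expR (X t) * ((1 + t * a) * sin (Y t) + t * b * cos (Y t)).

Let p : R := a ^+ 3 - 3 * a * b ^+ 2.
Let q : R := 3 * a ^+ 2 * b - b ^+ 3.

Let df (t : R) :
  is_derive t 1 f (t ^+ 2 * (expR (X t) * (p * cos (Y t) - q * sin (Y t)))).
Proof.
rewrite /f; apply: is_derive_eq.
by rewrite /GRing.scale /= /p /q; field.
Qed.

Let dg (t : R) :
  is_derive t 1 g (t ^+ 2 * (expR (X t) * (p * sin (Y t) + q * cos (Y t)))).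
Proof.
rewrite /g; apply: is_derive_eq.
by rewrite /GRing.scale /= /p /q; field.
Qed.

Let bound (r : R) : r <= 1 -> `|a| <= r -> `|b| <= r -> forall t c d : R,
  0 <= t <= 1 -> `|c| <= 1 -> `|d| <= 1 ->
  `|t ^+ 2 * (expR (X t) * (p * c + q * d))| <= 8 * expR 2 * r ^+ 3.
Proof.
move=> r1 ar br t c d /andP[t0 t1] c1 d1.
have r0 : 0 <= r by exact: le_trans ar.
have a1 := le_trans ar r1; have b1 := le_trans br r1.
have XE : expR (X t) <= expR 2.
  rewrite ler_expR /X; move: a1 b1; rewrite !ler_norml => /andP[? ?] /andP[? ?].
  have : - (t * a) <= 1 by nra.
  have : t ^+ 2 * ((a ^+ 2 - b ^+ 2) / 2) <= 1.
    have : a ^+ 2 <= 1 by nra.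
    have : 0 <= b ^+ 2 by rewrite sqr_ge0.
    have : 0 <= t ^+ 2 <= 1 by rewrite sqr_ge0 /=; nra.
    by move=> /andP[? ?] ? ?; nra.
  by lra.
have monomial (x y z : R) : `|x| <= r -> `|y| <= r -> `|z| <= r ->
    `|x * y * z| <= r ^+ 3.
  move=> xr yr zr; rewrite !normrM exprSr expr2.
  by rewrite ler_pM ?mulr_ge0// ler_pM.
have paq : `|p| <= 4 * r ^+ 3.
  have := monomial a a a ar ar ar; have := monomial a b b ar br br.
  rewrite (_ : a * a * a = a ^+ 3); last by ring.
  rewrite (_ : a * b * b = a * b ^+ 2); last by ring.
  by rewrite /p !ler_norml => /andP[? ?] /andP[? ?]; apply/andP; split; lra.
have qaq : `|q| <= 4 * r ^+ 3.
  have := monomial b b b br br br; have := monomial a a b ar ar br.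
  rewrite (_ : b * b * b = b ^+ 3); last by ring.
  rewrite (_ : a * a * b = a ^+ 2 * b); last by ring.
  by rewrite /q !ler_norml => /andP[? ?] /andP[? ?]; apply/andP; split; lra.
have r3 : 0 <= r ^+ 3 by rewrite exprn_ge0.
have pq : `|p * c + q * d| <= 8 * r ^+ 3.
  rewrite (le_trans (ler_normD _ _))// !normrM.
  have : `|p| * `|c| <= 4 * r ^+ 3 * 1 by rewrite ler_pM.
  have : `|q| * `|d| <= 4 * r ^+ 3 * 1 by rewrite ler_pM.
  by lra.
rewrite normrM normrX (ger0_norm t0) normrM (ger0_norm (expR_ge0 _)).
rewrite (_ : 8 * expR 2 * r ^+ 3 = 1 * (expR 2 * (8 * r ^+ 3))); last by ring.
rewrite ler_pM ?exprn_ge0 ?mulr_ge0 ?expR_ge0 ?exprn_ile1//.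
by rewrite ler_pM ?expR_ge0.
Qed.

Let X1 : X 1 = - a + (a ^+ 2 - b ^+ 2) / 2.
Proof. by rewrite /X; ring. Qed.

Let Y1 : Y 1 = - b + a * b.
Proof. by rewrite /Y; ring. Qed.

Let factor1 : (1 + a +i* b) * cexp (- (a +i* b) + (a +i* b) ^+ 2 / 2)
  = f 1 +i* g 1.
Proof.
have -> : - (a +i* b) + (a +i* b) ^+ 2 / 2 = X 1 +i* Y 1.
  rewrite X1 Y1 (_ : 2 = 2%:C); last by rewrite rmorphD.
  rewrite divc_real// expr2; apply/eqP; rewrite eq_complex /=.
  by apply/andP; split; apply/eqP; field.
by rewrite /f /g /cexp /polar; apply/eqP; rewrite eq_complex /=;
  apply/andP; split; apply/eqP; ring.
Qed.

Lemma weierstrass_coord_sub1 (u := a +i* b) : modulus u <= 1 ->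
  modulus ((1 + u) * cexp (- u + u ^+ 2 / 2) - 1)
    <= 16 * expR 2 * modulus u ^+ 3.
Proof.
move=> u1; rewrite /u factor1; set K := 8 * expR 2 * modulus u ^+ 3.
have [au bu] : `|a| <= modulus u /\ `|b| <= modulus u.
  by split; [exact: (Re_le_modulus u) | exact: (Im_le_modulus u)].
have f0 : f 0 = 1.
  by rewrite /f /X /Y !mul0r expr0n /= !mul0r oppr0 addr0 expR0 cos0; ring.
have g0 : g 0 = 0.
  by rewrite /g /X /Y !mul0r expr0n /= !mul0r oppr0 addr0 expR0 sin0; ring.
have fK : `|f 1 - 1| <= K.
  rewrite -[X in _ - X]f0; apply: (increment_le _ _ _ df) => t t01.
  rewrite -mulrN; apply: bound => //; rewrite ?normrN.
  - by rewrite ler_norml cos_geN1 cos_le1.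
  - by rewrite ler_norml sin_geN1 sin_le1.
have gK : `|g 1| <= K.
  rewrite -[g 1]subr0 -[X in _ - X]g0; apply: (increment_le _ _ _ dg) => t t01.
  apply: bound => //.
  - by rewrite ler_norml sin_geN1 sin_le1.
  - by rewrite ler_norml cos_geN1 cos_le1.
have -> : 16 * expR 2 * modulus (a +i* b) ^+ 3 = K + K by rewrite /K /u; ring.
apply: (le_trans (modulus_le_ReIm _)).
by rewrite [complex.Re _]/= [complex.Im _]/= subr0; exact: lerD.
Qed.

End Path.

Lemma weierstrass_factor_sub1 (u : R[i]) : modulus u <= 1 ->
  modulus ((1 + u) * cexp (- u + u ^+ 2 / 2) - 1)
    <= 16 * expR 2 * modulus u ^+ 3.
Proof. by case: u => a b; exact: weierstrass_coord_sub1. Qed.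

End WeierstrassFactor.

(** * Sums over squares of the lattice *)

Section SquareSums.
Local Open Scope nat_scope.

(** A square minus the origin grows by the shell of the points [(k, l)] with
    [max (k, l) = n]. *)
Lemma square_bigS (T : Type) (idx : T) (op : Monoid.com_law idx)
    (F : nat -> nat -> T) (n : nat) : 0 < n ->
  \big[op/idx]_(k < n.+1) \big[op/idx]_(l < n.+1 | 0 < k + l) F k l =
  op (\big[op/idx]_(k < n) \big[op/idx]_(l < n | 0 < k + l) F k l)
     (op (\big[op/idx]_(l < n.+1) F n l) (\big[op/idx]_(k < n) F k n)).
Proof.
move=> n0; rewrite big_ord_recr /=.
rewrite [X in op _ X = _](eq_bigl xpredT); last first.
  by move=> l; rewrite addn_gt0 n0.
rewrite [op (\big[op/idx]_(l < n.+1) F n l) _]Monoid.mulmC Monoid.mulmA.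
congr (op _ _); apply: etrans (big_split _ _ _ _ _).
apply: eq_bigr => k _.
by rewrite big_mkcond big_ord_recr /= -big_mkcond addn_gt0 n0 orbT.
Qed.

End SquareSums.

Section RealSums.
Context {R : realType}.

(** The sum of [F] over the points of the square [0 <= k, l < n] other than the
    origin. *)
Definition square_sum (F : nat -> nat -> R) (n : nat) : R :=
  \sum_(k < n) \sum_(l < n | (0 < k + l)%N) F k l.

(** The sum of [F] over the shell [max (k, l) = n], which has [2 n + 1]
    points. *)
Definition shell_sum (F : nat -> nat -> R) (n : nat) : R :=
  \sum_(l < n.+1) F n l + \sum_(k < n) F k n.

Lemma square_sumS F n : (0 < n)%N ->
  square_sum F n.+1 = square_sum F n + shell_sum F n.
Proof. exact: (@square_bigS R 0 +%R). Qed.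

Lemma square_sum1 F : square_sum F 1 = 0.
Proof.
rewrite /square_sum big_ord_recl big_ord0 addr0 big_mkcond big_ord_recl.
by rewrite big_ord0 /= addr0.
Qed.

Lemma square_sum_shells F m n : (0 < m)%N -> (m <= n)%N ->
  square_sum F n = square_sum F m + \sum_(m <= i < n) shell_sum F i.
Proof.
move=> m0; elim: n => [|n IH]; first by rewrite leqn0 => /eqP m00; rewrite m00 in m0.
rewrite leq_eqVlt => /orP[/eqP <-|]; first by rewrite big_geq// addr0.
rewrite ltnS => mn; rewrite square_sumS ?(leq_trans m0)// IH//.
by rewrite big_nat_recr//= -addrA.
Qed.

Lemma shell_sum_le F G n : (0 < n)%N ->
  (forall k l, maxn k l = n -> F k l <= G k l) ->
  shell_sum F n <= shell_sum G n.
Proof.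
move=> n0 FG; apply: lerD; apply: ler_sum => -[i /= ilt] _; apply: FG.
  by apply/maxn_idPl; rewrite -ltnS.
by apply/maxn_idPr; exact: ltnW.
Qed.

Lemma shell_sum_cst (c : R) n : shell_sum (fun _ _ => c) n = (2 * n%:R + 1) * c.
Proof.
by rewrite /shell_sum !sumr_const !card_ord -(mulr_natl c n.+1) -(mulr_natl c n) -natr1; ring.
Qed.

Lemma norm_shell_sum_le F (c : R) n : (0 < n)%N -> 0 <= c ->
  (forall k l, maxn k l = n -> `|F k l| <= c) ->
  `|shell_sum F n| <= 3 * n%:R * c.
Proof.
move=> n0 c0 Fc; apply: (@le_trans _ _ (shell_sum (fun k l => `|F k l|) n)).
  rewrite /shell_sum (le_trans (ler_normD _ _))// lerD//; exact: ler_norm_sum.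
apply: (le_trans (shell_sum_le _ (fun _ _ => c) n n0 Fc)).
rewrite shell_sum_cst ler_wpM2r//.
have : (1 : R) <= n%:R by rewrite ler1n.
by lra.
Qed.

Lemma shell_sumD F G n :
  shell_sum (fun k l => F k l + G k l) n = shell_sum F n + shell_sum G n.
Proof. by rewrite /shell_sum !big_split /= addrACA. Qed.

Lemma shell_sumZ (c : R) F n :
  shell_sum (fun k l => c * F k l) n = c * shell_sum F n.
Proof. by rewrite /shell_sum -!mulr_sumr mulrDr. Qed.

Lemma eq_shell_sum F G n :
  (forall k l, maxn k l = n -> F k l = G k l) -> shell_sum F n = shell_sum G n.
Proof.
move=> FG; congr (_ + _); apply: eq_bigr => -[i /= ilt] _; apply: FG.
  by apply/maxn_idPl; rewrite -ltnS.
by apply/maxn_idPr; exact: ltnW.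
Qed.

Lemma inv_sqr_le (x : R) : 1 <= x -> (x ^+ 2)^-1 <= 2 * (x^-1 - (x + 1)^-1).
Proof.
move=> x1; have x0 : 0 < x by exact: lt_le_trans x1.
have x10 : 0 < x + 1 by rewrite addr_gt0.
have -> : 2 * (x^-1 - (x + 1)^-1) = (x ^+ 2)^-1 * (2 * x / (x + 1)).
  by field; rewrite !gt_eqF.
rewrite ler_peMr ?invr_ge0 ?sqr_ge0// ler_pdivlMr//; lra.
Qed.

Lemma sum_inv_sqr_le (m n : nat) : (0 < m)%N -> (m <= n)%N ->
  \sum_(m <= i < n) ((i%:R : R) ^+ 2)^-1 <= 2 / m%:R.
Proof.
move=> m0 mn.
suff : \sum_(m <= i < n) ((i%:R : R) ^+ 2)^-1 <= 2 / m%:R - 2 / n%:R.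
  by move=> /le_trans; apply; rewrite gerBl divr_ge0.
elim: n mn => [|n IH]; first by rewrite leqn0 => /eqP m00; rewrite m00 in m0.
rewrite leq_eqVlt => /orP[/eqP <-|]; first by rewrite big_geq// subrr.
rewrite ltnS => mn; rewrite big_nat_recr//=.
have n1 : (1 : R) <= n%:R by rewrite ler1n (leq_trans m0).
have := inv_sqr_le n%:R n1; rewrite natr1 => i1.
by apply: (le_trans (lerD (IH mn) i1)); rewrite mulrBr addrA subrK.
Qed.

Lemma harmonic_sum_ln (n : nat) : (0 < n)%N ->
  0 <= \sum_(1 <= i < n) (i%:R : R)^-1 - ln (n%:R : R) <= 1.
Proof.
move=> n0.
suff : 0 <= \sum_(1 <= i < n) (i%:R : R)^-1 - ln (n%:R : R) <= 1 - n%:R^-1.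
  by move=> /andP[-> /= /le_trans]; apply; rewrite gerBl invr_ge0.
have step (S x : R) : 0 < x -> 0 <= S - ln x <= 1 - x^-1 ->
    0 <= S + x^-1 - ln (x + 1) <= 1 - (x + 1)^-1.
  move=> x0 /andP[lo hi].
  have x1 : 0 < x + 1 by rewrite addr_gt0 ?ltr01.
  have up : ln (x + 1) - ln x <= x^-1.
    rewrite -ln_div ?posrE// mulrDl mul1r divff ?gt_eqF//.
    by apply: le_ln1Dx; rewrite (lt_le_trans (ltrN10 _))// invr_ge0 ltW.
  have dn : (x + 1)^-1 <= ln (x + 1) - ln x.
    rewrite -[leRHS]opprB lerNr -ln_div ?posrE//.
    have -> : x / (x + 1) = 1 + - (x + 1)^-1 by field; rewrite gt_eqF.
    by apply: le_ln1Dx; rewrite ltrN2 invf_lt1// ltrDr.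
  by apply/andP; split; lra.
case: n n0 => // n _; elim: n => [|n IH].
  by rewrite big_geq// ln1 invr1 !subrr lexx.
rewrite big_nat_recr//= -[n.+2%:R]natr1; exact: step.
Qed.

(** Each summand exceeds the telescoping term
    [1 / (x + i h) - 1 / (x + (i + 1) h)] by at most [h^2 / x^3]. *)
Lemma sum_inv_sqr_arith (x h : R) (n : nat) : 0 < x -> 0 < h ->
  0 <= \sum_(i < n) h / (x + i%:R * h) ^+ 2 - (x^-1 - (x + n%:R * h)^-1)
    <= n%:R * (h ^+ 2 / x ^+ 3).
Proof.
move=> x0 h0; elim: n => [|n /andP[lo hi]].
  by rewrite big_ord0 !mul0r addr0 !subrr lexx.
rewrite big_ord_recr /=; set y := x + n%:R * h.
have xy : x <= y by rewrite lerDl mulr_ge0// ltW.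
have y0 : 0 < y by exact: lt_le_trans xy.
have -> : x + n.+1%:R * h = y + h by rewrite /y -natr1; ring.
have yh0 : 0 < y + h by rewrite addr_gt0.
have step : h / y ^+ 2 - (y^-1 - (y + h)^-1) = h ^+ 2 / (y ^+ 2 * (y + h)).
  by field; rewrite !gt_eqF.
have step0 : 0 <= h ^+ 2 / (y ^+ 2 * (y + h)).
  by rewrite divr_ge0 ?mulr_ge0 ?exprn_ge0 ?ltW.
have step1 : h ^+ 2 / (y ^+ 2 * (y + h)) <= h ^+ 2 / x ^+ 3.
  rewrite ler_pM2l ?exprn_gt0// lef_pV2 ?posrE ?mulr_gt0 ?exprn_gt0//.
  rewrite exprSr; apply: ler_pM.
  - by rewrite exprn_ge0// ltW.
  - exact: ltW.
  - by rewrite ler_sqr// nnegrE ltW.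
  - by rewrite ltW// (le_lt_trans xy)// ltrDl.
by rewrite -natr1 mulrDl mul1r; apply/andP; split; lra.
Qed.

Section Lattice.
Variable tau : R.
Hypothesis tau0 : 0 < tau.

(** The points [k tau + l] at which the double product has its factors. *)
Definition lattice_point (k l : nat) : R := k%:R * tau + l%:R.

Lemma lattice_point_bounds (k l n : nat) : maxn k l = n ->
  Num.min 1 tau * n%:R <= lattice_point k l <= (tau + 1) * n%:R.
Proof.
move=> <-; rewrite /lattice_point.
have k0 : (0 : R) <= k%:R by []. have l0 : (0 : R) <= l%:R by [].
have [m1 mt] : Num.min 1 tau <= 1 /\ Num.min 1 tau <= tau.
  by rewrite !ge_min !lexx orbT.
have m0 : 0 <= Num.min 1 tau by rewrite le_min ler01 ltW.
move: (Num.min 1 tau) m1 mt m0 => mu m1 mt m0.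
have [kl|lk] := leqP k l.
  have : (k%:R : R) <= l%:R by rewrite ler_nat.
  by move=> ?; apply/andP; split; nra.
have : (l%:R : R) <= k%:R by rewrite ler_nat ltnW.
by move=> ?; apply/andP; split; nra.
Qed.

(** The two sides of the shell contribute
    [(1 / tau - 1 / (tau + 1)) / n] and [1 / ((tau + 1) n)], up to [O(1 / n^2)]:
    each is an arithmetic progression, of step 1 and [tau] respectively. *)
Lemma shell_sum_inv_sqr (n : nat) : (0 < n)%N ->
  `|shell_sum (fun k l => (lattice_point k l ^+ 2)^-1) n - (tau * n%:R)^-1|
    <= (tau ^- 3 + tau + 1) / n%:R ^+ 2.
Proof.
move=> n0; have nR : (0 : R) < n%:R by rewrite ltr0n.
have nt : 0 < n%:R * tau by rewrite mulr_gt0.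
rewrite /shell_sum big_ord_recr /= /lattice_point.
have /andP[A0 A1] := sum_inv_sqr_arith (n%:R * tau) 1 n nt ltr01.
have /andP[B0 B1] := sum_inv_sqr_arith n%:R tau n nR tau0.
set A := (\sum_(i < n) _); set B := (\sum_(i < n) _).
have EA : \sum_(i < n) 1 / (n%:R * tau + i%:R * 1) ^+ 2 = A.
  by apply: eq_bigr => i _; rewrite mulr1 mul1r.
have EB : \sum_(i < n) tau / (n%:R + i%:R * tau) ^+ 2 = tau * B.
  by rewrite mulr_sumr; apply: eq_bigr => i _; rewrite [n%:R + _]addrC.
rewrite EA in A0 A1; rewrite EB in B0 B1.
have A1' : n%:R * (1 ^+ 2 / (n%:R * tau) ^+ 3) = tau ^- 3 / n%:R ^+ 2.
  by field; rewrite !gt_eqF.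
have B1' : n%:R * (tau ^+ 2 / n%:R ^+ 3) = tau * (tau / n%:R ^+ 2).
  by field; rewrite !gt_eqF.
rewrite A1' in A1; rewrite B1' in B1.
have T1 : 0 < tau + 1 by rewrite addr_gt0 ?ltr01.
have B0' : 0 <= B - tau^-1 * (n%:R^-1 - (n%:R + n%:R * tau)^-1).
  by rewrite -(pmulr_rge0 _ tau0) mulrBr mulVKf ?gt_eqF.
have B2' : B - tau^-1 * (n%:R^-1 - (n%:R + n%:R * tau)^-1) <= tau / n%:R ^+ 2.
  by rewrite -(ler_pM2l tau0) mulrBr mulVKf ?gt_eqF.
have main : (n%:R * tau)^-1 - (n%:R * tau + n%:R * 1)^-1
    + tau^-1 * (n%:R^-1 - (n%:R + n%:R * tau)^-1) = (tau * n%:R)^-1.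
  field; rewrite !gt_eqF ?addr_gt0//.
have X0 : 0 <= ((n%:R * tau + n%:R) ^+ 2)^-1.
  by rewrite invr_ge0 sqr_ge0.
have X1 : ((n%:R * tau + n%:R) ^+ 2)^-1 <= 1 / n%:R ^+ 2.
  rewrite mul1r lef_pV2 ?posrE ?exprn_gt0 ?addr_gt0//.
  by rewrite ler_sqr ?nnegrE ?(ltW nR) ?ltW ?addr_gt0// ltrDr.
rewrite !mulrDl ler_norml; apply/andP; split; lra.
Qed.

End Lattice.
End RealSums.

(** * The factors of the double product *)

Section LogEstimates.
Context {R : realType}.

Lemma ln_le_subr1 (x : R) : 0 < x -> ln x <= x - 1.
Proof. by move=> x0; rewrite -[in ln x](subrKC 1 x); apply: le_ln1Dx; lra. Qed.

Lemma norm_ln_near1 (x : R) : `|x - 1| <= 2^-1 -> `|ln x| <= 2 * `|x - 1|.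
Proof.
move=> x1; have x2 : 2^-1 <= x by move: x1; rewrite ler_norml; lra.
have x0 : 0 < x by exact: lt_le_trans x2.
have a1 := ln_le_subr1 x x0; have n0 := normr_ge0 (x - 1).
have le1 := ler_norm (x - 1).
have a2 : - ln x <= 2 * `|x - 1|.
  rewrite -lnV ?posrE//; have xi : 0 < x^-1 by rewrite invr_gt0.
  apply: (le_trans (ln_le_subr1 _ xi)).
  have -> : x^-1 - 1 = (1 - x) / x by field; rewrite gt_eqF.
  rewrite ler_pdivrMr//.
  have : 1 - x <= `|x - 1| by rewrite distrC ler_norm.
  by nra.
by rewrite ler_norml; apply/andP; split; lra.
Qed.

Lemma norm_modulus_sub1 (z : R[i]) : `|modulus z - 1| <= modulus (z - 1).
Proof.
have := modulusD_le (z - 1) 1; rewrite subrK modulus1 => a.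
have := modulusD_le (1 - z) z; rewrite subrK modulus1 -modulusN opprB => b.
by rewrite ler_norml; apply/andP; split; lra.
Qed.

(** The term [1 / |Im u|] bounds [- ln |1 + u|] when [1 + u] is close to 0. *)
Lemma norm_ln_modulus1D (u : R[i]) : complex.Im u != 0 ->
  `|ln (modulus (1 + u)) - complex.Re u|
    <= 2 * modulus u + `|complex.Im u|^-1.
Proof.
move=> u0; have y0 : 0 < `|complex.Im u| by rewrite normr_gt0.
have Rle := Re_le_modulus u; have u_ge0 := modulus_ge0 u.
have Imle : `|complex.Im u| <= modulus (1 + u).
  by apply: le_trans (Im_le_modulus _); rewrite ImD /= add0r.
have m0 : 0 < modulus (1 + u) by exact: lt_le_trans Imle.
have yV0 : 0 < `|complex.Im u|^-1 by rewrite invr_gt0.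
have lo : - `|complex.Im u|^-1 <= ln (modulus (1 + u)).
  apply: (@le_trans _ _ (ln `|complex.Im u|)); last by rewrite ler_ln ?posrE.
  by rewrite lerNl -lnV ?posrE//; have := ln_le_subr1 _ yV0; lra.
have hi : ln (modulus (1 + u)) <= modulus u.
  apply: (le_trans (ln_le_subr1 _ m0)).
  by have := modulusD_le 1 u; rewrite modulus1; lra.
move: Rle; rewrite !ler_norml => /andP[? ?]; apply/andP; split; lra.
Qed.

End LogEstimates.

Section PartialProducts.
Context {R : realType}.
Variable tau : R.
Hypothesis tau0 : 0 < tau.

Let mu : R := Num.min 1 tau.

Let mu0 : 0 < mu.
Proof. by rewrite /mu lt_min ltr01. Qed.

Let w_lo (k l n : nat) : maxn k l = n -> mu * n%:R <= lattice_point tau k l.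
Proof. by move=> /(lattice_point_bounds tau tau0)/andP[]. Qed.

Let w_hi (k l n : nat) : maxn k l = n ->
  lattice_point tau k l <= (tau + 1) * n%:R.
Proof. by move=> /(lattice_point_bounds tau tau0)/andP[]. Qed.

Let w_gt0 (k l n : nat) : (0 < n)%N -> maxn k l = n ->
  0 < lattice_point tau k l.
Proof.
by move=> n0 kl; apply: lt_le_trans (w_lo _ _ _ kl); rewrite mulr_gt0 ?ltr0n.
Qed.

Let quot (z : R[i]) (k l : nat) : R[i] := z / (lattice_point tau k l)%:C.

Lemma barnes_factorE (z : R[i]) k l (u := z / (lattice_point tau k l)%:C) :
  barnes_factor tau k l z = (1 + u) * cexp (- u + u ^+ 2 / 2).
Proof.
rewrite /barnes_factor -/(lattice_point tau k l) -/u.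
congr (_ * cexp (_ + _)).
by rewrite /u expr_div_n invfM [2^-1 * _]mulrC mulrA.
Qed.

Let modulus_quot z k l : 0 < lattice_point tau k l ->
  modulus (quot z k l) = modulus z / lattice_point tau k l.
Proof.
by move=> w0; rewrite /quot modulusM modulusV modulus_real gtr0_norm.
Qed.

Let quotE z k l : 0 < lattice_point tau k l -> quot z k l =
  (complex.Re z / lattice_point tau k l) +i* (complex.Im z / lattice_point tau k l).
Proof. by move=> w0; rewrite /quot divc_real// gt_eqF. Qed.

Lemma modulus_barnes_factor_gt0 z k l : 0 < lattice_point tau k l ->
  complex.Im z != 0 -> 0 < modulus (barnes_factor tau k l z).
Proof.
move=> w0 z0; rewrite barnes_factorE -/(quot z k l) modulusM modulus_cexp.
rewrite mulr_gt0 ?expR_gt0// (lt_le_trans _ (Im_le_modulus _))//.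
by rewrite normr_gt0 ImD quotE// add0r mulf_neq0// invr_eq0 gt_eqF.
Qed.

(** The logarithm of the modulus of the factor of index [(k, l)] at [z]; it is
    0 by convention where the factor vanishes. *)
Definition log_factor (z : R[i]) (k l : nat) : R :=
  ln (modulus (barnes_factor tau k l z)).

Lemma log_factorE z k l : 0 < lattice_point tau k l -> complex.Im z != 0 ->
  log_factor z k l =
    (ln (modulus (1 + quot z k l)) - complex.Re (quot z k l))
    + complex.Re (z ^+ 2) / 2 * (lattice_point tau k l ^+ 2)^-1.
Proof.
move=> w0 z0; rewrite /log_factor barnes_factorE -/(quot z k l) modulusM.
have u0 : complex.Im (quot z k l) != 0.
  by rewrite quotE// mulf_neq0// invr_eq0 gt_eqF.
have m0 : 0 < modulus (1 + quot z k l).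
  rewrite (lt_le_trans _ (Im_le_modulus _))// normr_gt0 ImD.
  by rewrite add0r.
rewrite lnM ?posrE// ?modulus_cexp ?expR_gt0// expRK -addrA; congr (_ + _).
rewrite ReD ReN; congr (_ + _).
rewrite (_ : 2 = 2%:C); last by rewrite rmorphD.
rewrite divc_real// quotE// expr2 Re_sqr /=; field.
by rewrite gt_eqF.
Qed.

(** The points [z] of modulus at most [2 r] at distance at least [r / 4] from
    the real axis, where all the zeros of the product lie. *)
Section Cone.
Variables (r : R) (z : R[i]).
Hypotheses (r1 : 1 <= r) (z2r : modulus z <= 2 * r)
  (Imz : r / 4 <= `|complex.Im z|).

Let r0 : 0 < r. Proof. exact: lt_le_trans r1. Qed.

Let Imz_gt0 : 0 < `|complex.Im z|.
Proof. by apply: lt_le_trans Imz; rewrite divr_gt0. Qed.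

Let Imz_neq0 : complex.Im z != 0.
Proof. by rewrite -normr_gt0. Qed.

Lemma norm_Re_sqr : `|complex.Re (z ^+ 2)| <= 4 * r ^+ 2.
Proof.
apply: (le_trans (Re_le_modulus _)); rewrite expr2 modulusM -expr2.
have -> : 4 * r ^+ 2 = (2 * r) ^+ 2 by ring.
by rewrite ler_sqr ?nnegrE ?modulus_ge0// mulr_ge0// ltW.
Qed.

Let modulus_quot_le k l n : (0 < n)%N -> maxn k l = n ->
  modulus (quot z k l) <= 2 * r / (mu * n%:R).
Proof.
move=> n0 kl; have w0 := w_gt0 _ _ _ n0 kl.
rewrite modulus_quot//; apply: ler_pM => //.
- exact: modulus_ge0.
- by rewrite invr_ge0 ltW.
- by rewrite lef_pV2 ?posrE ?w_lo// mulr_gt0 ?ltr0n.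
Qed.

(** Shells inside the square of side comparable to [r]: the term [Re (z^2) / (2
    w^2)] dominates, and each shell has an error [O(r)]. *)
Lemma shell_sum_near (c : R) n : (0 < n)%N -> n%:R <= c * r ->
  `|shell_sum (log_factor z) n - complex.Re (z ^+ 2) / (2 * tau) * n%:R^-1|
  <= 3 * (4 / mu + 4 * (tau + 1) * c ^+ 2) * r
     + 2 * (tau ^- 3 + tau + 1) * r ^+ 2 * (n%:R ^+ 2)^-1.
Proof.
move=> n0 ncr; have nR : (0 : R) < n%:R by rewrite ltr0n.
pose err k l := ln (modulus (1 + quot z k l)) - complex.Re (quot z k l).
have errE k l : maxn k l = n ->
    `|err k l| <= (4 / mu + 4 * (tau + 1) * c ^+ 2) * (r / n%:R).
  move=> kl; have w0 := w_gt0 _ _ _ n0 kl.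
  have u0 : complex.Im (quot z k l) != 0.
    by rewrite quotE// mulf_neq0// invr_eq0 gt_eqF.
  apply: (le_trans (norm_ln_modulus1D _ u0)); rewrite [leRHS]mulrDl lerD//.
    have -> : 4 / mu * (r / n%:R) = 2 * (2 * r / (mu * n%:R)).
      by field; rewrite !gt_eqF.
    by rewrite ler_pM2l ?ltr0n// modulus_quot_le.
  rewrite quotE//= normrM normfV (gtr0_norm w0) invfM invrK mulrC.
  rewrite ler_pdivrMr//.
  apply: (le_trans (w_hi _ _ _ kl)).
  apply: (@le_trans _ _ (4 * (tau + 1) * c ^+ 2 * (r / n%:R) * (r / 4))).
    have -> : 4 * (tau + 1) * c ^+ 2 * (r / n%:R) * (r / 4)
      = (tau + 1) * ((c * r) ^+ 2 / n%:R) by field; rewrite gt_eqF.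
    rewrite ler_pM2l ?addr_gt0 ?ltr01// ler_pdivlMr// -expr2.
    have cr0 : 0 < c * r by exact: lt_le_trans ncr.
    by rewrite ler_sqr ?nnegrE ?(ltW nR) ?(ltW cr0).
  apply: ler_wpM2l => //.
  rewrite mulr_ge0 ?divr_ge0 ?(ltW r0)// mulr_ge0 ?sqr_ge0// mulr_ge0//.
  by rewrite addr_ge0 ?(ltW tau0).
have K0 : 0 <= (4 / mu + 4 * (tau + 1) * c ^+ 2) * (r / n%:R).
  exact: le_trans (errE n 0%N (maxn0 n)).
have shE : shell_sum (log_factor z) n = shell_sum err n
    + complex.Re (z ^+ 2) / 2 * shell_sum (fun k l => (lattice_point tau k l ^+ 2)^-1) n.
  rewrite -shell_sumZ -shell_sumD; apply: eq_shell_sum => k l kl.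
  by rewrite log_factorE// (w_gt0 _ _ _ n0 kl).
have B := norm_shell_sum_le err _ n n0 K0 errE.
have C := shell_sum_inv_sqr tau tau0 n n0.
set S := shell_sum (fun k l => (_ ^+ 2)^-1) n in shE C.
have -> : shell_sum (log_factor z) n - complex.Re (z ^+ 2) / (2 * tau) * n%:R^-1
  = shell_sum err n + complex.Re (z ^+ 2) / 2 * (S - (tau * n%:R)^-1).
  by rewrite shE; field; rewrite !gt_eqF.
apply: (le_trans (ler_normD _ _)); apply: lerD.
  apply: (le_trans B); rewrite le_eqVlt; apply/orP; left; apply/eqP.
  by field; rewrite !gt_eqF.
rewrite normrM.
have -> : 2 * (tau ^- 3 + tau + 1) * r ^+ 2 * (n%:R ^+ 2)^-1
  = (4 * r ^+ 2 / 2) * ((tau ^- 3 + tau + 1) / n%:R ^+ 2).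
  by field; rewrite !gt_eqF.
apply: ler_pM => //.
by rewrite normrM [X in _ * X]ger0_norm ?invr_ge0// ler_pM2r ?invr_gt0// norm_Re_sqr.
Qed.

(* Where [A0 |u| <= 1], the bound [16 e^2 |u|^3] on the distance from the factor
   to 1 is at most 1/2. *)
Let A0 : R := 32 * expR 2.

Let A0_ge1 : 1 <= A0.
Proof. by rewrite /A0; have := expR_ge1Dx (2 : R); lra. Qed.

Lemma barnes_factor_far k l n : A0 * (2 * r) <= mu * n%:R -> maxn k l = n ->
  modulus (barnes_factor tau k l z - 1) <= A0 / 2 * (2 * r / (mu * n%:R)) ^+ 3
  /\ modulus (barnes_factor tau k l z - 1) <= 2^-1.
Proof.
move=> nA kl.
have r2 : 0 < 2 * r by rewrite mulr_gt0.
have mn0 : 0 < mu * n%:R.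
  by apply: lt_le_trans nA; rewrite mulr_gt0// (lt_le_trans _ A0_ge1).
have n0 : (0 < n)%N by rewrite -(ltr0n R) -(pmulr_rgt0 _ mu0).
have := modulus_quot_le k l n n0 kl; set u := quot z k l => uq.
set t := 2 * r / (mu * n%:R) in uq *.
have t0 : 0 <= t by rewrite /t divr_ge0// ltW.
have At : A0 * t <= 1 by rewrite /t mulrA ler_pdivrMr// mul1r.
have t1 : t <= 1 by have := A0_ge1; nra.
have u1 : modulus u <= 1 by exact: le_trans t1.
have bound : modulus (barnes_factor tau k l z - 1) <= A0 / 2 * t ^+ 3.
  rewrite barnes_factorE -/(quot z k l) -/u.
  apply: (le_trans (weierstrass_factor_sub1 _ u1)).
  have -> : 16 * expR 2 = A0 / 2 by rewrite /A0; field.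
  rewrite ler_pM2l ?divr_gt0// ?(lt_le_trans _ A0_ge1)//.
  by rewrite ler_pXn2r// ?nnegrE ?modulus_ge0.
split=> //; apply: (le_trans bound).
have t2 : t ^+ 2 <= 1 by rewrite exprn_ile1.
rewrite exprS mulrA.
have t20 : 0 <= t ^+ 2 by exact: sqr_ge0.
by nra.
Qed.

Lemma shell_sum_far n : A0 * (2 * r) <= mu * n%:R ->
  `|shell_sum (log_factor z) n| <= 24 * A0 / mu ^+ 3 * r ^+ 3 * (n%:R ^+ 2)^-1.
Proof.
move=> nA.
have r2 : 0 < 2 * r by rewrite mulr_gt0.
have mn0 : 0 < mu * n%:R.
  by apply: lt_le_trans nA; rewrite mulr_gt0// (lt_le_trans _ A0_ge1).
have nR : (0 : R) < n%:R by rewrite -(pmulr_rgt0 _ mu0).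
have n0 : (0 < n)%N by rewrite -(ltr0n R).
have c0 : 0 <= A0 * (2 * r / (mu * n%:R)) ^+ 3.
  by rewrite mulr_ge0 ?exprn_ge0 ?divr_ge0 ?ltW// (lt_le_trans _ A0_ge1).
have -> : 24 * A0 / mu ^+ 3 * r ^+ 3 * (n%:R ^+ 2)^-1
   = 3 * n%:R * (A0 * (2 * r / (mu * n%:R)) ^+ 3).
  by field; rewrite !gt_eqF.
apply: norm_shell_sum_le => // k l kl.
have [f1 f2] := barnes_factor_far k l n nA kl.
have g := norm_modulus_sub1 (barnes_factor tau k l z).
rewrite /log_factor; apply: (le_trans (norm_ln_near1 _ (le_trans g f2))).
by apply: (@le_trans _ _ (2 * (A0 / 2 * (2 * r / (mu * n%:R)) ^+ 3))); lra.
Qed.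

Lemma modulus_partial_product n : (0 < n)%N ->
  modulus (\prod_(k < n) \prod_(l < n | (0 < k + l)%N) barnes_factor tau k l z)
  = expR (square_sum (log_factor z) n).
Proof.
move=> n0; rewrite /square_sum modulus_prod (big_morph _ (@expRD R) (@expR0 R)).
apply: eq_bigr => k _; rewrite modulus_prod (big_morph _ (@expRD R) (@expR0 R)).
apply: eq_bigr => l kl; rewrite /log_factor lnK// posrE.
apply: modulus_barnes_factor_gt0 => //.
by rewrite (@w_gt0 k l (maxn k l))// leq_max -addn_gt0.
Qed.

End Cone.
End PartialProducts.

(** * Convergence of the double product and growth of the double gamma function *)

Section ComplexLimits.
Context {R : realType}.

Lemma clim_coord (u : nat -> R[i]) (x y : R) :
  (fun n => complex.Re (u n)) @ \oo --> x ->
  (fun n => complex.Im (u n)) @ \oo --> y ->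
  clim u = x +i* y.
Proof.
move=> ux uy.
suff ul : (u : nat -> R[i]^o) @ \oo --> (x +i* y : R[i]^o).
  exact: (cvg_lim (@norm_hausdorff _ _) ul).
apply/cvgrPdist_lt => -[e e'] /=; rewrite ltcE /= => /andP[/eqP -> e0].
have e2 : 0 < e / 2 by rewrite divr_gt0.
move/cvgrPdist_lt : ux => /(_ _ e2) ux; move/cvgrPdist_lt : uy => /(_ _ e2) uy.
near=> n; rewrite normc_def -sqr_modulus sqrtr_sqr ger0_norm ?modulus_ge0// ltcR.
apply: (le_lt_trans (modulus_le_ReIm _)).
rewrite ReD ReN ImD ImN /= [e]splitr; apply: ltrD.
  by near: n.
by near: n.
Unshelve. all: by end_near. Qed.

Lemma modulus_clim (u : nat -> R[i]) (lo hi : R) :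
  cvgn (fun n => complex.Re (u n)) -> cvgn (fun n => complex.Im (u n)) ->
  0 <= lo -> (\forall n \near \oo, lo <= modulus (u n) <= hi) ->
  lo <= modulus (clim u) <= hi.
Proof.
move=> cx cy lo0 uh.
have hi0 : 0 <= hi.
  by have [n /andP[/(le_trans lo0)]] := filter_ex uh; exact: le_trans.
set x := limn (fun n => complex.Re (u n)).
set y := limn (fun n => complex.Im (u n)).
have -> : clim u = x +i* y by exact: clim_coord.
have c2 : (fun n => modulus (u n) ^+ 2) @ \oo --> modulus (x +i* y) ^+ 2.
  under eq_fun do rewrite sqr_modulus.
  rewrite sqr_modulus /=; under eq_fun do rewrite !expr2.
  by rewrite !expr2; apply: cvgD; apply: cvgM.
have E := cvg_lim (@norm_hausdorff _ _) c2.
have cc : cvgn (fun n => modulus (u n) ^+ 2) by apply/cvg_ex; eexists; exact: c2.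
rewrite -(@ler_pXn2r _ 2) ?nnegrE ?modulus_ge0//.
rewrite -[X in _ && X](@ler_pXn2r _ 2) ?nnegrE ?modulus_ge0//.
rewrite -E; apply/andP; split.
  apply: limr_ge => //; near=> n.
  rewrite ler_pXn2r ?nnegrE ?modulus_ge0//.
  by suff /andP[] : lo <= modulus (u n) <= hi by []; near: n.
apply: limr_le => //; near=> n.
rewrite ler_pXn2r ?nnegrE ?modulus_ge0//.
by suff /andP[] : lo <= modulus (u n) <= hi by []; near: n.
Unshelve. all: by end_near. Qed.

(** The bound [K / n^2] on the increments is absorbed by a multiple of the
    telescoping [1 / n], which makes the sequence monotone. *)
Lemma cvgn_bounded_increments (u : nat -> R) (M : nat) (B K : R) :
  (0 < M)%N -> 0 <= K ->
  (forall n, (M <= n)%N -> u n <= B) ->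
  (forall n, (M <= n)%N -> `|u n.+1 - u n| <= K * (n%:R ^+ 2)^-1) ->
  cvgn u.
Proof.
case: M => // M _ K0 uB uK.
pose v n := u (n + M.+1)%N - 2 * K * harmonic (n + M)%N.
have hM : (fun n => harmonic (n + M)%N : R) @ \oo --> 0.
  by rewrite (cvg_shiftn M (harmonic : R^nat)); exact: cvg_harmonic.
have cv : cvgn v.
  apply: nondecreasing_is_cvgn.
    apply/nondecreasing_seqP => n; rewrite /v /harmonic /=.
    have nM : (M < n + M.+1)%N by rewrite -[X in (X <= _)%N]add0n leq_add2r.
    have := uK _ nM; rewrite ler_norml => /andP[+ _].
    rewrite addSnnS addSn -addnS addnS.
    set x : R := (n + M).+1%:R; have -> : (n + M).+2%:R = x + 1 by rewrite natr1.
    have i : (x ^+ 2)^-1 <= 2 * (x^-1 - (x + 1)^-1) by apply: inv_sqr_le; rewrite ler1n.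
    by clearbody x; have := ler_wpM2l K0 i; lra.
  exists B => _ [n _ <-]; rewrite /v.
  rewrite lerBlDr (le_trans (uB _ _)) ?leq_addl//.
  by rewrite lerDl !mulr_ge0// invr_ge0.
have cu : (fun n => u (n + M.+1)%N) @ \oo --> limn v + 2 * K * 0.
  have -> : (fun n => u (n + M.+1)%N)
      = (fun n => v n + 2 * K * harmonic (n + M)%N).
    by apply/funext => n; rewrite /v subrK.
  by apply: cvgD => //; apply: cvgMr.
move: cu; rewrite (cvg_shiftn M.+1 u) => cu.
by apply/cvg_ex; eexists; exact: cu.
Qed.

Lemma modulus_prod_sub1 (A B : R[i]) (a b : R) :
  modulus (A - 1) <= expR a - 1 -> modulus (B - 1) <= expR b - 1 ->
  modulus (A * B - 1) <= expR (a + b) - 1.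
Proof.
move=> Aa Bb; rewrite expRD.
have -> : A * B - 1 = (A - 1) * (B - 1) + (A - 1) + (B - 1) by ring.
apply: (le_trans (modulusD_le _ _)); apply: (le_trans (lerD (modulusD_le _ _) (lexx _))).
rewrite modulusM; have := modulus_ge0 (A - 1); have := modulus_ge0 (B - 1).
set x := modulus (A - 1) in Aa *; set y := modulus (B - 1) in Bb *.
move=> y0 x0; have : x * y <= (expR a - 1) * (expR b - 1) by rewrite ler_pM.
by lra.
Qed.

Lemma modulus_bigprod_sub1 (I : Type) (s : seq I) (F : I -> R[i]) :
  modulus (\prod_(i <- s) F i - 1)
    <= expR (\sum_(i <- s) modulus (F i - 1)) - 1.
Proof.
elim/big_ind2 : _ => [|A a B b|i _].
- by rewrite subrr expR0 subrr /modulus Normc.normc0.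
- exact: modulus_prod_sub1.
- by have := expR_ge1Dx (modulus (F i - 1)); lra.
Qed.

Lemma expR_sub1_le (x : R) : expR x - 1 <= x * expR x.
Proof.
have := expR_ge1Dx (- x); rewrite -(ler_pM2r (expR_gt0 x)) expRN mulVf ?gt_eqF ?expR_gt0//.
by lra.
Qed.

End ComplexLimits.

Section BarnesProduct.
Context {R : realType}.
Variable tau : R.
Hypothesis tau0 : 0 < tau.

Let mu : R := Num.min 1 tau.

Let mu0 : 0 < mu.
Proof. by rewrite /mu lt_min ltr01. Qed.

Let mu1 : mu <= 1.
Proof. by rewrite /mu ge_min lexx. Qed.

Let A0 : R := 32 * expR 2.

Let A0_ge1 : 1 <= A0.
Proof. by rewrite /A0; have := expR_ge1Dx (2 : R); lra. Qed.

(** The partial products over squares of side at least [M], with [M] comparable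
    to [r], all have modulus [exp (Re (z^2) / (2 tau) ln r + O(r^2))]; the second
    property of [M] places the factors outside the square near 1. *)
Lemma partial_log_estimate : exists2 C : R, 0 <= C & forall (r : R) (z : R[i]),
  1 <= r -> modulus z <= 2 * r -> r / 4 <= `|complex.Im z| ->
  exists M : nat, [/\ (0 < M)%N, A0 * (2 * r) <= mu * M%:R &
    forall n, (M <= n)%N ->
      `|square_sum (log_factor tau z) n
        - complex.Re (z ^+ 2) / (2 * tau) * ln r| <= C * r ^+ 2].
Proof.
pose c : R := A0 * 2 / mu + 1.
(* [K1] and [K2] are the constants of [shell_sum_near], [K3] is that of
   [shell_sum_far]. *)
pose K1 : R := 3 * (4 / mu + 4 * (tau + 1) * c ^+ 2).
pose K2 : R := 2 * (tau ^- 3 + tau + 1).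
pose K3 : R := 24 * A0 / mu ^+ 3.
have A00 : 0 < A0 by exact: lt_le_trans A0_ge1.
have c1 : 1 <= c by rewrite lerDr divr_ge0 ?(ltW mu0)// mulr_ge0// ltW.
have c0 : 0 < c by exact: lt_le_trans c1.
have K10 : 0 <= K1.
  rewrite /K1 mulr_ge0// addr_ge0 ?divr_ge0 ?(ltW mu0)//.
  by rewrite mulr_ge0 ?sqr_ge0// mulr_ge0// addr_ge0 ?(ltW tau0).
have K20 : 0 <= K2.
  have t3 : 0 <= tau ^- 3 by rewrite invr_ge0 exprn_ge0// ltW.
  by rewrite /K2 mulr_ge0// addr_ge0// addr_ge0// ltW.
have K30 : 0 <= K3.
  by rewrite /K3 divr_ge0 ?exprn_ge0 ?(ltW mu0)// mulr_ge0// (ltW A00).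
exists (c * K1 + 2 * K2 + 2 * K3 + 2 / tau * (1 + c)).
  have c1' : 0 <= 2 / tau * (1 + c).
    by rewrite mulr_ge0 ?divr_ge0 ?(ltW tau0)// addr_ge0// ltW.
  have cK : 0 <= c * K1 by rewrite mulr_ge0// ltW.
  rewrite addr_ge0// addr_ge0//; last exact: mulr_ge0.
  by rewrite addr_ge0//; exact: mulr_ge0.
move=> r z r1 z2r Imz.
have r0 : 0 < r by exact: lt_le_trans r1.
pose x := A0 * (2 * r) / mu.
have x0 : 0 <= x by rewrite divr_ge0 ?(ltW mu0)// mulr_ge0 ?(ltW A00)// mulr_ge0// ltW.
have rx : r <= x.
  rewrite ler_pdivlMr//; apply: (@le_trans _ _ (r * 1)).
    by rewrite ler_pM2l.
  apply: (@le_trans _ _ (1 * (2 * r))); first lra.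
  by rewrite ler_pM2r// mulr_gt0.
(* Thus [r <= x <= M <= c r]. *)
pose M := (Num.truncn x).+1.
have xM : x <= M%:R by exact/ltW/truncnS_gt.
have Mc : M%:R <= c * r.
  apply: (@le_trans _ _ (x + 1)).
    by rewrite -natr1 lerD2r; have /andP[] := truncn_itv x0.
  rewrite /c mulrDl mul1r; apply: lerD => //.
  rewrite /x le_eqVlt; apply/orP; left; apply/eqP; field.
  by rewrite gt_eqF.
have M0 : (0 < M)%N by [].
have rM : r <= M%:R by exact: le_trans xM.
have MR : (0 : R) < M%:R by exact: lt_le_trans rM.
have AM : A0 * (2 * r) <= mu * M%:R by rewrite [leRHS]mulrC -ler_pdivrMr.
exists M; split => // n Mn.
rewrite (square_sum_shells _ 1 n)// ?(leq_trans M0)// square_sum1 add0r.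
rewrite (big_cat_nat M0 Mn) /=.
set q := complex.Re (z ^+ 2) / (2 * tau).
set H := \sum_(1 <= i < M) (i%:R : R)^-1.
have near : `|\sum_(1 <= i < M) shell_sum (log_factor tau z) i - q * H|
    <= c * K1 * r ^+ 2 + 2 * K2 * r ^+ 2.
  rewrite /H mulr_sumr -sumrB; apply: (le_trans (ler_norm_sum _ _ _)).
  apply: (@le_trans _ _ (\sum_(1 <= i < M) (K1 * r + K2 * r ^+ 2 * (i%:R ^+ 2)^-1))).
    rewrite big_nat_cond [leRHS]big_nat_cond; apply: ler_sum => i.
    rewrite andbT => /andP[i1 iM].
    apply: shell_sum_near => //; apply: le_trans Mc.
    by rewrite ler_nat ltnW.
  rewrite big_split /=; apply: lerD.
    rewrite sumr_const_nat -[leLHS]mulr_natl.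
    apply: (@le_trans _ _ ((c * r) * (K1 * r))); last by rewrite le_eqVlt; apply/orP; left; apply/eqP; ring.
    apply: ler_wpM2r; first by rewrite mulr_ge0// ltW.
    by apply: le_trans Mc; rewrite ler_nat leq_subr.
  rewrite -mulr_sumr.
  have := sum_inv_sqr_le (R := R) 1 M isT M0; rewrite divr1 => S2.
  apply: (@le_trans _ _ (K2 * r ^+ 2 * 2)); last by lra.
  by apply: ler_wpM2l => //; rewrite mulr_ge0 ?sqr_ge0.
have far : `|\sum_(M <= i < n) shell_sum (log_factor tau z) i| <= 2 * K3 * r ^+ 2.
  apply: (le_trans (ler_norm_sum _ _ _)).
  apply: (@le_trans _ _ (\sum_(M <= i < n) (K3 * r ^+ 3 * (i%:R ^+ 2)^-1))).
    rewrite big_nat_cond [leRHS]big_nat_cond; apply: ler_sum => i.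
    rewrite andbT => /andP[iM _].
    apply: shell_sum_far => //; apply: (le_trans AM).
    by rewrite ler_pM2l// ler_nat.
  rewrite -mulr_sumr.
  have S2 := sum_inv_sqr_le (R := R) M n M0 Mn.
  have S3 : \sum_(M <= i < n) ((i%:R : R) ^+ 2)^-1 <= 2 / r.
    by apply: (le_trans S2); rewrite ler_pM2l// lef_pV2 ?posrE.
  have -> : 2 * K3 * r ^+ 2 = K3 * r ^+ 3 * (2 / r) by field; rewrite gt_eqF.
  by apply: ler_wpM2l => //; rewrite mulr_ge0 ?exprn_ge0// ltW.
have HM : `|q * H - q * ln r| <= 2 / tau * (1 + c) * r ^+ 2.
  rewrite -mulrBr normrM.
  have -> : 2 / tau * (1 + c) * r ^+ 2 = (2 / tau * r ^+ 2) * (1 + c) by ring.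
  apply: ler_pM => //.
    rewrite /q normrM normfV (gtr0_norm (mulr_gt0 _ tau0))//.
    have -> : 2 / tau * r ^+ 2 = 4 * r ^+ 2 / (2 * tau) by field; rewrite gt_eqF.
    by rewrite ler_pM2r ?invr_gt0 ?mulr_gt0//; exact: norm_Re_sqr.
  have /andP[h0 h1] := harmonic_sum_ln (R := R) M M0; rewrite -/H in h0 h1.
  have l0 : ln r <= ln M%:R by rewrite ler_ln ?posrE.
  have l1 : ln M%:R - ln r <= c.
    rewrite -ln_div ?posrE//.
    apply: (@le_trans _ _ (M%:R / r)); last by rewrite ler_pdivrMr.
    by apply: (le_trans (ln_le_subr1 _ _)); rewrite ?divr_gt0// gerBl.
  by rewrite ler_norml; apply/andP; split; lra.
set N1 := \sum_(1 <= i < M) _ in near *; set N2 := \sum_(M <= i < n) _ in far *.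
have -> : N1 + N2 - q * ln r = (N1 - q * H) + N2 + (q * H - q * ln r) by ring.
rewrite [leRHS]mulrDl [X in _ <= X + _]mulrDl [X in _ <= X + _ + _]mulrDl.
apply: (le_trans (ler_normD _ _)); apply: lerD => //.
by apply: (le_trans (ler_normD _ _)); apply: lerD.
Qed.

(** The bounds on the partial products pass to the limit, whose existence is
    proved at the same time: they bound the partial products, and the product
    over the shell [n] is [1 + O(1 / n^2)]. *)
Lemma barnes_product_estimate : exists2 C : R, 0 <= C & forall (r : R) (z : R[i]),
  1 <= r -> modulus z <= 2 * r -> r / 4 <= `|complex.Im z| ->
  exists E : R, modulus (barnes_product tau z) = expR E /\
    `|E - complex.Re (z ^+ 2) / (2 * tau) * ln r| <= C * r ^+ 2.
Proof.
have [C C0 PC] := partial_log_estimate.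
exists C => // r z r1 z2r Imz.
have r0 : 0 < r by exact: lt_le_trans r1.
have [M [M0 AM EM]] := PC r z r1 z2r Imz.
set q := complex.Re (z ^+ 2) / (2 * tau) in EM *.
pose P n : R[i] :=
  \prod_(k < n) \prod_(l < n | (0 < k + l)%N) barnes_factor tau k l z.
have PE n : (M <= n)%N -> expR (q * ln r - C * r ^+ 2) <= modulus (P n)
    <= expR (q * ln r + C * r ^+ 2).
  move=> Mn; rewrite /P (modulus_partial_product tau tau0 r z r1 Imz) ?(leq_trans M0)//.
  rewrite !ler_expR; have := EM n Mn; rewrite ler_norml => /andP[? ?].
  by apply/andP; split; lra.
pose B := expR (q * ln r + C * r ^+ 2).
pose K := 12 * A0 / mu ^+ 3 * r ^+ 3.
have A00 : 0 < A0 by exact: lt_le_trans A0_ge1.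
have K0 : 0 <= K.
  rewrite /K mulr_ge0 ?exprn_ge0 ?(ltW r0)// divr_ge0 ?exprn_ge0 ?(ltW mu0)//.
  by rewrite mulr_ge0 ?(ltW A00).
have incr n : (M <= n)%N ->
    modulus (P n.+1 - P n) <= B * (K * expR K) * (n%:R ^+ 2)^-1.
  move=> Mn; have n0 : (0 < n)%N by exact: leq_trans Mn.
  have nR : (0 : R) < n%:R by rewrite ltr0n.
  have n1 : (1 : R) <= n%:R by rewrite ler1n.
  have An : A0 * (2 * r) <= mu * n%:R.
    by apply: (le_trans AM); rewrite ler_pM2l// ler_nat.
  have -> : P n.+1 = P n * ((\prod_(l < n.+1) barnes_factor tau n l z)
      * \prod_(k < n) barnes_factor tau k n z).
    exact: (@square_bigS R[i] 1 *%R (fun k l => barnes_factor tau k l z)).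
  rewrite -[X in _ - X]mulr1 -mulrBr modulusM.
  rewrite -mulrA; apply: ler_pM; rewrite ?modulus_ge0//.
    by have /andP[] := PE n Mn.
  set s := shell_sum (fun k l => modulus (barnes_factor tau k l z - 1)) n.
  have s0 : 0 <= s by rewrite addr_ge0// sumr_ge0// => i _; exact: modulus_ge0.
  have sK : s <= K * (n%:R ^+ 2)^-1.
    have -> : K * (n%:R ^+ 2)^-1
        = 3 * n%:R * (A0 / 2 * (2 * r / (mu * n%:R)) ^+ 3).
      by rewrite /K; field; rewrite !gt_eqF.
    rewrite -[s]ger0_norm//; apply: norm_shell_sum_le => //.
      rewrite mulr_ge0 ?divr_ge0 ?(ltW A00)//.
      by rewrite exprn_ge0// divr_ge0 ?mulr_ge0 ?(ltW r0) ?(ltW mu0).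
    move=> k l kl; rewrite ger0_norm ?modulus_ge0//.
    by have [] := barnes_factor_far tau tau0 r z r1 z2r k l n An kl.
  apply: (@le_trans _ _ (expR s - 1)).
    by apply: modulus_prod_sub1; exact: modulus_bigprod_sub1.
  apply: (le_trans (expR_sub1_le s)).
  rewrite mulrAC; apply: ler_pM => //.
  rewrite ler_expR (le_trans sK)// ler_piMr// invf_le1 ?exprn_gt0//.
  by rewrite expr_ge1.
have BK0 : 0 <= B * (K * expR K).
  by rewrite mulr_ge0 ?expR_ge0// mulr_ge0 ?expR_ge0.
have cRe : cvgn (fun n => complex.Re (P n)).
  apply: (cvgn_bounded_increments _ M B _ M0 BK0) => n Mn.
    have /andP[_] := PE n Mn; apply: le_trans.
    exact: le_trans (ler_norm _) (Re_le_modulus _).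
  by apply: le_trans (incr n Mn); rewrite -ReN -ReD; exact: Re_le_modulus.
have cIm : cvgn (fun n => complex.Im (P n)).
  apply: (cvgn_bounded_increments _ M B _ M0 BK0) => n Mn.
    have /andP[_] := PE n Mn; apply: le_trans.
    exact: le_trans (ler_norm _) (Im_le_modulus _).
  by apply: le_trans (incr n Mn); rewrite -ImN -ImD; exact: Im_le_modulus.
have /andP[lo hi] : expR (q * ln r - C * r ^+ 2) <= modulus (barnes_product tau z)
    <= expR (q * ln r + C * r ^+ 2).
  apply: modulus_clim => //.
  by near=> n; apply: PE; near: n; exact: nbhs_infty_ge.
have P0 : 0 < modulus (barnes_product tau z).
  by apply: lt_le_trans lo; exact: expR_gt0.
exists (ln (modulus (barnes_product tau z))); rewrite lnK ?posrE//; split=> //.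
move: lo hi; rewrite -[modulus _]lnK ?posrE// !ler_expR expRK => lo hi.
by rewrite ler_norml; apply/andP; split; lra.
Unshelve. all: by end_near. Qed.

(** The constants [c] of the exponential factor may be arbitrary: that factor
    is [exp (O(|s|^2))].  The shift by [w] changes [Re (z^2) ln |s|] by
    [O(|s| ln |s|)]. *)
Lemma barnesG_estimate (w : R[i]) : exists2 C : R, 0 <= C &
  exists2 r0 : R, 1 <= r0 & forall s : R[i],
  r0 <= modulus s -> modulus s / 2 <= `|complex.Im s| ->
  exists E : R, modulus (barnesG tau (w + s)) = expR E /\
    `|E - complex.Re (s ^+ 2) / (2 * tau) * ln (modulus s)| <= C * modulus s ^+ 2.
Proof.
have [C C0 BC] := barnes_product_estimate.
set c := barnes_constants tau; pose W := modulus w.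
have W0 : 0 <= W by exact: modulus_ge0.
pose D1 := (2 + `|ln tau|) + 2.
pose D2 := 2 * `|c.1| / tau + 2 * `|c.2| / tau ^+ 2.
pose D3 := (2 * W + W ^+ 2) / (2 * tau).
have D10 : 0 <= D1 by rewrite /D1 !addr_ge0.
have D20 : 0 <= D2 by rewrite /D2 addr_ge0 ?divr_ge0 ?mulr_ge0 ?exprn_ge0 ?(ltW tau0).
have D30 : 0 <= D3.
  rewrite /D3 divr_ge0// ?addr_ge0 ?sqr_ge0//; first exact: mulr_ge0.
  by rewrite mulr_ge0// ltW.
exists (C + D1 + D2 + D3); first by rewrite addr_ge0// addr_ge0// addr_ge0.
(* From this modulus on, [w + s] lies in the region of [barnes_product_estimate]
   with [r = |s|]. *)
exists (4 * W + 1); first by lra.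
move=> s; set r := modulus s => rW sIm.
have r1 : 1 <= r by apply: le_trans rW; lra.
have r0 : 0 < r by exact: lt_le_trans r1.
have rr : r <= r ^+ 2 by rewrite expr2 ler_peMl// ltW.
pose z := w + s.
have z2r : modulus z <= 2 * r by apply: (le_trans (modulusD_le _ _)); rewrite -/W -/r; lra.
have Imz : r / 4 <= `|complex.Im z|.
  have := Im_le_modulus w; have := ler_normB (complex.Im z) (complex.Im w).
  by rewrite /z ImD addrAC subrr add0r; rewrite -/W; lra.
have zr : r / 4 <= modulus z by apply: (le_trans Imz); exact: Im_le_modulus.
have z0 : 0 < modulus z by apply: lt_le_trans zr; rewrite divr_gt0.
have [E [PE Eb]] := BC r z r1 z2r Imz.
set e := c.1%:C * z / tau%:C + c.2%:C * z ^+ 2 / (2 * tau%:C ^+ 2).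
exists (ln (modulus z / tau) + complex.Re e + E); split.
  rewrite /barnesG /barnes_form -/c -/z -/e !modulusM modulus_cexp modulusV.
  rewrite modulus_real gtr0_norm// PE !expRD lnK// posrE divr_gt0//.
have lnr0 : 0 <= ln r by rewrite ln_ge0.
have lnr : ln r <= r by apply: (le_trans (ln_le_subr1 _ r0)); lra.
have b1 : `|ln (modulus z / tau)| <= D1 * r ^+ 2.
  rewrite ln_div ?posrE//.
  have hi : ln (modulus z) <= 2 * r by apply: (le_trans (ln_le_subr1 _ z0)); lra.
  have lo : - 4 <= ln (modulus z).
    have r4 : 0 < r / 4 by rewrite divr_gt0.
    apply: (@le_trans _ _ (ln (r / 4))); last by rewrite ler_ln ?posrE.
    rewrite ln_div ?posrE//.
    have := ln_le_subr1 (4 : R) (ltr0n _ 4); lra.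
  have lt := ler_norm (ln tau); have := ler_norm (- ln tau); rewrite normrN => lt'.
  have tt : `|ln tau| <= `|ln tau| * r ^+ 2 by rewrite ler_peMr// (le_trans r1).
  have r21 : 1 <= r ^+ 2 by exact: le_trans rr.
  by rewrite /D1 ler_norml !mulrDl; apply/andP; split; lra.
have b2 : `|complex.Re e| <= D2 * r ^+ 2.
  apply: (le_trans (Re_le_modulus _)); apply: (le_trans (modulusD_le _ _)).
  have m2 : modulus (2 : R[i]) = 2.
    by rewrite (_ : 2 = 2%:C) ?modulus_real ?ger0_norm// rmorphD.
  rewrite !modulusM !modulusV !modulusM !modulus_real (gtr0_norm tau0) m2.
  rewrite /D2 [leRHS]mulrDl; apply: lerD.
    have -> : 2 * `|c.1| / tau * r ^+ 2 = `|c.1| * (2 * r ^+ 2) / tau by ring.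
    rewrite ler_pM2r ?invr_gt0//; apply: ler_wpM2l => //.
    by apply: (le_trans z2r); rewrite ler_pM2l.
  have -> : 2 * `|c.2| / tau ^+ 2 * r ^+ 2 = `|c.2| * (2 * r) ^+ 2 / (2 * (tau * tau)).
    by field; rewrite gt_eqF.
  rewrite ler_pM2r ?invr_gt0 ?mulr_gt0//; apply: ler_wpM2l => //.
  by rewrite -expr2 ler_sqr ?nnegrE ?modulus_ge0// mulr_ge0// ltW.
have b3 : `|complex.Re (z ^+ 2) / (2 * tau) * ln r
    - complex.Re (s ^+ 2) / (2 * tau) * ln r| <= D3 * r ^+ 2.
  rewrite -!mulrBl !normrM.
  have d1 : `|complex.Re (z ^+ 2) - complex.Re (s ^+ 2)| <= (2 * W + W ^+ 2) * r.
    rewrite -ReN -ReD; apply: (le_trans (Re_le_modulus _)).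
    have -> : z ^+ 2 - s ^+ 2 = w * s + w * s + w * w by rewrite /z; ring.
    apply: (le_trans (modulusD_le _ _)).
    apply: (le_trans (lerD (modulusD_le _ _) (lexx _))).
    rewrite !modulusM -/W -/r.
    have : W * W <= W * W * r by rewrite ler_peMr// mulr_ge0.
    by lra.
  rewrite normfV (gtr0_norm (mulr_gt0 _ tau0))// (ger0_norm lnr0).
  have -> : D3 * r ^+ 2 = ((2 * W + W ^+ 2) * r) / (2 * tau) * r.
    by rewrite /D3; field; rewrite gt_eqF.
  apply: ler_pM => //.
    by rewrite divr_ge0// mulr_ge0// ltW.
  by rewrite ler_pM2r// invr_gt0 mulr_gt0.
set L := complex.Re (z ^+ 2) / _ * _ in Eb b3; set L' := complex.Re (s ^+ 2) / _ * _ in b3 *.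
have -> : ln (modulus z / tau) + complex.Re e + E - L'
  = (E - L) + ln (modulus z / tau) + complex.Re e + (L - L') by ring.
rewrite [leRHS]mulrDl [X in _ <= X + _]mulrDl [X in _ <= X + _ + _]mulrDl.
apply: (le_trans (ler_normD _ _)); apply: lerD => //.
apply: (le_trans (ler_normD _ _)); apply: lerD => //.
by apply: (le_trans (ler_normD _ _)); apply: lerD.
Qed.

End BarnesProduct.

(** * Growth of the integrand *)

Section LogGrowth.
Context {R : realType}.
Variable tau : R.
Hypothesis tau0 : 0 < tau.

(** [f] does not vanish at the points [s] of large modulus of the cone
    [|Im s| >= |s| / 2], and there
    [ln |f s| = N Re (s^2) / (2 tau) ln |s| + O(|s|^2)].  The cone is invariant
    under [s |-> - s]. *)
Definition log_growth (N : R) (f : R[i] -> R[i]) : Prop :=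
  exists2 C : R, 0 <= C & exists2 r0 : R, 1 <= r0 & forall s : R[i],
    r0 <= modulus s -> modulus s / 2 <= `|complex.Im s| ->
    exists E : R, modulus (f s) = expR E /\
      `|E - N * (complex.Re (s ^+ 2) / (2 * tau) * ln (modulus s))|
        <= C * modulus s ^+ 2.

Lemma log_growth_barnesG (w : R[i]) : log_growth 1 (fun s => barnesG tau (w + s)).
Proof.
have [C C0 [r0 r01 H]] := barnesG_estimate tau tau0 w.
by exists C => //; exists r0 => // s h1 h2; rewrite mul1r; exact: H.
Qed.

Lemma log_growth_reflect (N : R) (f : R[i] -> R[i]) :
  log_growth N f -> log_growth N (fun s => f (- s)).
Proof.
move=> [C C0 [r0 r01 H]]; exists C => //; exists r0 => // s h1 h2.
have := H (- s); rewrite modulusN ImN normrN sqrrN; exact.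
Qed.

Lemma log_growthM (N1 N2 : R) (f g : R[i] -> R[i]) :
  log_growth N1 f -> log_growth N2 g -> log_growth (N1 + N2) (fun s => f s * g s).
Proof.
move=> [C C0 [r r1 H]] [C' C'0 [r' r'1 H']].
exists (C + C'); first by rewrite addr_ge0.
exists (Num.max r r'); first by rewrite le_max r1.
move=> s; rewrite ge_max => /andP[h h'] hIm.
have [E [fE Eb]] := H s h hIm; have [E' [gE Eb']] := H' s h' hIm.
exists (E + E'); rewrite modulusM fE gE expRD; split => //.
set L := _ * ln _ in Eb Eb' *.
have -> : E + E' - (N1 + N2) * L = (E - N1 * L) + (E' - N2 * L) by ring.
by rewrite mulrDl (le_trans (ler_normD _ _))// lerD.
Qed.

Lemma log_growthV (N : R) (f : R[i] -> R[i]) :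
  log_growth N f -> log_growth (- N) (fun s => (f s)^-1).
Proof.
move=> [C C0 [r r1 H]]; exists C => //; exists r => // s h hIm.
have [E [fE Eb]] := H s h hIm; exists (- E); rewrite modulusV fE expRN.
by split => //; rewrite mulNr -opprB normrN opprK addrC.
Qed.

Lemma log_growth_cexp (h : R[i] -> R[i]) (C : R) : 0 <= C ->
  (forall s, 1 <= modulus s -> modulus (h s) <= C * modulus s ^+ 2) ->
  log_growth 0 (fun s => cexp (h s)).
Proof.
move=> C0 hC; exists C => //; exists 1 => // s s1 _.
exists (complex.Re (h s)); rewrite modulus_cexp; split => //.
by rewrite mul0r subr0 (le_trans (Re_le_modulus _)) ?hC.
Qed.

Lemma log_growth_prod (I : Type) (l : seq I) (P : pred I)
    (F : I -> R[i] -> R[i]) : (forall i, log_growth 1 (F i)) ->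
  log_growth (\sum_(i <- l | P i) 1) (fun s => \prod_(i <- l | P i) F i s).
Proof.
move=> FG; elim: l => [|i l IH].
  have G1 : log_growth 0 (fun s => cexp (0 * s)).
    apply: (log_growth_cexp _ 0) => // s _.
    by rewrite mul0r mul0r /modulus Normc.normc0.
  rewrite big_nil; under eq_fun do rewrite big_nil.
  have -> : (fun _ : R[i] => 1) = (fun s : R[i] => cexp (0 * s)) => //.
  apply/funext => s; rewrite mul0r /cexp /polar /= expR0 cos0 sin0 mulr0.
  by rewrite mulr1.
rewrite big_cons.
have -> : (fun s => \prod_(j <- i :: l | P j) F j s) = (fun s =>
    if P i then F i s * \prod_(j <- l | P j) F j s else \prod_(j <- l | P j) F j s).
  by apply/funext => s; rewrite big_cons.
by case: (P i) => //; exact: log_growthM.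
Qed.

Lemma sum_ord_lt (q m : nat) : (m <= q)%N ->
  \sum_(j < q | (j < m)%N) (1 : R) = m%:R.
Proof.
by move=> mq; rewrite -(big_ord_widen q (fun _ => 1 : R) mq) sumr_const card_ord.
Qed.

Lemma sum_ord_ge (q m : nat) : (m <= q)%N ->
  \sum_(j < q | (m <= j)%N) (1 : R) = q%:R - m%:R.
Proof.
move=> mq; rewrite -(sum_ord_lt q m mq) -[q in q%:R]card_ord -sumr_const.
rewrite [X in X - _](bigID (fun j : 'I_q => (j < m)%N)) /= addrAC subrr add0r.
by apply: eq_bigl => j; rewrite -leqNgt.
Qed.

Lemma log_growth_twisted (m n p q : nat) (a : 'I_p -> R[i]) (b : 'I_q -> R[i])
    (alpha logz : R[i]) : (m <= q)%N -> (n <= p)%N ->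
  log_growth (indexN m n p q)%:~R (twisted (phi tau m n a b alpha) logz).
Proof.
move=> mq np; rewrite /twisted /phi /calG.
have -> : (indexN m n p q)%:~R
  = m%:R + n%:R - ((q%:R - m%:R) + (p%:R - n%:R)) + 0 + 0 :> R.
  by rewrite /indexN !rmorphB /= -!pmulrn natrM natrD; ring.
rewrite -(sum_ord_ge q m mq) -(sum_ord_ge p n np).
rewrite -(sum_ord_lt q m mq) -(sum_ord_lt p n np).
apply: log_growthM; first apply: log_growthM; first apply: log_growthM.
- apply: log_growthM; apply: log_growth_prod => j.
    exact: (log_growth_reflect _ _ (log_growth_barnesG (b j))).
  exact: log_growth_barnesG.
- apply: log_growthV; apply: log_growthM; apply: log_growth_prod => j.
    exact: log_growth_barnesG.
  exact: (log_growth_reflect _ _ (log_growth_barnesG (a j))).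
- apply: (log_growth_cexp _ (pi * modulus alpha / tau)).
    by rewrite divr_ge0 ?(ltW tau0)// mulr_ge0 ?pi_ge0// modulus_ge0.
  move=> s _; rewrite expr2 !modulusM modulusV !modulus_real.
  rewrite (ger0_norm (pi_ge0 _)) (gtr0_norm tau0) mulrAC -expr2 mulrAC.
  by rewrite lexx.
- apply: (log_growth_cexp _ (modulus logz)); first exact: modulus_ge0.
  move=> s s1; rewrite modulusM modulusN mulrC.
  by rewrite ler_wpM2l ?modulus_ge0// expr2 ler_peMl// modulus_ge0.
Qed.

Section Consequences.
Variables (N : R) (f : R[i] -> R[i]).
Hypotheses (N0 : N < 0) (fN : log_growth N f).

(** The hypothesis on [Re (s^2)] implies that [s] lies in the cone
    [|Im s| >= |s| / 2]. *)
Lemma log_growth_large (delta B : R) : 0 < delta ->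
  exists r1 : R, forall s, r1 <= modulus s ->
    complex.Re (s ^+ 2) <= - delta * modulus s ^+ 2 -> B <= modulus (f s).
Proof.
move=> d0; have [C C0 [r0 r01 H]] := fN.
pose k := - N * delta / (2 * tau).
have k0 : 0 < k by rewrite !mulr_gt0 ?invr_gt0 ?mulr_gt0 ?oppr_gt0.
(* When [k ln r >= C + 1], the exponent is at least [r^2], hence at least [r],
   and [exp r >= r >= B]. *)
exists (Num.max r0 (Num.max B (expR ((C + 1) / k)))) => s.
rewrite !ge_max => /and3P[rs Bs es] sd.
set r := modulus s in rs Bs es sd *.
have r1 : 1 <= r by exact: le_trans rs.
have r0' : 0 < r by exact: lt_le_trans r1.
have hIm : r / 2 <= `|complex.Im s|.
  rewrite -(@ler_pXn2r _ 2) ?nnegrE ?divr_ge0 ?(ltW r0')// real_normK ?num_real//.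
  have := sqr_modulus s; rewrite -/r => rE.
  move: sd; rewrite Re_sqr.
  have dr : 0 <= delta * r ^+ 2 by rewrite mulr_ge0 ?sqr_ge0 ?ltW.
  have r2 : 0 <= r ^+ 2 by rewrite sqr_ge0.
  by rewrite expr_div_n; lra.
have [E [-> Eb]] := H s rs hIm; rewrite -/r in Eb.
have lnr : (C + 1) / k <= ln r by rewrite -ler_expR lnK ?posrE.
have lnr' : C + 1 <= k * ln r by rewrite mulrC -ler_pdivrMr.
have lnr0 : 0 <= ln r by rewrite ln_ge0.
have main : k * ln r * r ^+ 2
    <= N * (complex.Re (s ^+ 2) / (2 * tau) * ln r).
  have -> : k * ln r * r ^+ 2 = - N * (ln r / (2 * tau)) * (delta * r ^+ 2).
    by rewrite /k; field; rewrite gt_eqF.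
  have -> : N * (complex.Re (s ^+ 2) / (2 * tau) * ln r)
    = - N * (ln r / (2 * tau)) * (- complex.Re (s ^+ 2)).
    by field; rewrite gt_eqF.
  apply: ler_wpM2l; last by lra.
  by rewrite mulr_ge0 ?oppr_ge0 ?(ltW N0)// divr_ge0// mulr_ge0// ltW.
have rr : r <= r ^+ 2 by rewrite expr2 ler_peMl// ltW.
have := ler_wpM2r (sqr_ge0 r) lnr'; rewrite mulrDl mul1r => kr.
have Er : r <= E by move: Eb; rewrite ler_norml => /andP[? _]; lra.
apply: (le_trans Bs); apply: (le_trans Er).
by have := expR_ge1Dx E; lra.
Qed.

Lemma log_growth_vertical (theta : R) : theta = pi / 2 \/ theta = - (pi / 2) ->
  exists eps : R -> R,
    eps r @[r --> +oo] --> 0 /\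
    \forall r \near +oo, modulus (f (polar r theta))
      = expR (- N / (2 * tau) * (r ^+ 2 * ln r) * (1 + eps r)).
Proof.
move=> th; have [C C0 [r0 r01 H]] := fN.
pose k := - N / (2 * tau).
have k0 : 0 < k by rewrite divr_gt0 ?oppr_gt0// mulr_gt0.
have cth : cos theta = 0.
  by case: th => ->; rewrite ?cosN cos_pihalf.
have sth : `|sin theta| = 1.
  by case: th => ->; rewrite ?sinN ?normrN sin_pihalf normr1.
have H' r : r0 <= r -> exists E : R, modulus (f (polar r theta)) = expR E /\
    `|E - k * (r ^+ 2 * ln r)| <= C * r ^+ 2.
  move=> rr0; have r_ge0 : 0 <= r by apply: le_trans rr0; exact: le_trans r01.
  have := H (polar r theta); rewrite modulus_polar// => /(_ rr0)[|E [EE Eb]].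
    by rewrite /= normrM sth mulr1 ger0_norm//; lra.
  exists E; split => //; move: Eb; rewrite Re_sqr /= cth mulr0 expr0n /= sub0r.
  rewrite exprMn -[sin theta ^+ 2]real_normK ?num_real// sth expr1n mulr1.
  have -> : N * (- r ^+ 2 / (2 * tau) * ln r) = k * (r ^+ 2 * ln r) => //.
  by rewrite /k; field; rewrite gt_eqF.
pose eps r := ln (modulus (f (polar r theta))) / (k * (r ^+ 2 * ln r)) - 1.
exists eps; split.
  apply/cvgrPdist_le => e e0; near=> r.
  have r2 : 2 <= r by near: r; apply: nbhs_pinfty_ge; rewrite num_real.
  have rr0 : r0 <= r by near: r; apply: nbhs_pinfty_ge; rewrite num_real.
  have re : expR (C / (k * e)) <= r by near: r; apply: nbhs_pinfty_ge; rewrite num_real.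
  have rpos : 0 < r by exact: lt_le_trans r2.
  have lnr : 0 < ln r by rewrite ln_gt0//; lra.
  have lnC : C / (k * e) <= ln r by rewrite -ler_expR lnK ?posrE.
  have [E [EE Eb]] := H' r rr0.
  have D0 : 0 < k * (r ^+ 2 * ln r) by rewrite mulr_gt0// mulr_gt0// exprn_gt0.
  rewrite sub0r normrN /eps EE expRK.
  have -> : E / (k * (r ^+ 2 * ln r)) - 1
     = (E - k * (r ^+ 2 * ln r)) / (k * (r ^+ 2 * ln r)).
    by rewrite mulrBl divff ?gt_eqF.
  rewrite normrM normfV (gtr0_norm D0) ler_pdivrMr//.
  apply: (le_trans Eb).
  have -> : e * (k * (r ^+ 2 * ln r)) = ln r * (k * e) * r ^+ 2 by ring.
  rewrite ler_wpM2r ?sqr_ge0//.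
  by rewrite -ler_pdivrMr// mulr_gt0.
near=> r.
have r2 : 2 <= r by near: r; apply: nbhs_pinfty_ge; rewrite num_real.
have rr0 : r0 <= r by near: r; apply: nbhs_pinfty_ge; rewrite num_real.
have rpos : 0 < r by exact: lt_le_trans r2.
have lnr : 0 < ln r by rewrite ln_gt0//; lra.
have [E [EE Eb]] := H' r rr0.
rewrite /eps EE expRK -/k subrKC mulrC divfK// gt_eqF//.
by rewrite mulr_gt0// mulr_gt0// exprn_gt0.
Unshelve. all: by end_near. Qed.

Lemma log_growth_vertical_pinfty (theta : R) :
  theta = pi / 2 \/ theta = - (pi / 2) ->
  modulus (f (polar r theta)) @[r --> +oo] --> +oo.
Proof.
move=> th.
have cth : cos theta = 0 by case: th => ->; rewrite ?cosN cos_pihalf.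
have sth : sin theta ^+ 2 = 1 by have := cos2Dsin2 theta; rewrite cth expr0n /= add0r.
apply/cvgryPge => B; have [r1 H] := log_growth_large 1 B ltr01.
near=> r.
have r_ge0 : 0 <= r by near: r; apply: nbhs_pinfty_ge; rewrite num_real.
have rr1 : r1 <= r by near: r; apply: nbhs_pinfty_ge; rewrite num_real.
apply: H; rewrite modulus_polar//.
by rewrite Re_sqr /= cth mulr0 expr0n /= exprMn sth mulr1 sub0r mulN1r.
Unshelve. all: by end_near. Qed.

End Consequences.
End LogGrowth.

(** * Integrals along curves *)

Section CurveIntegrals.
Context {R : realType}.

(** Monotonicity of the integral of nonnegative functions holds without any
    measurability, since the integral is a supremum over simple functions. *)
Lemma le_integral_nonmeasurable (D : set R) (f g : R -> \bar R) :
  (forall x, D x -> 0 <= f x)%E -> (forall x, 0 <= g x)%E ->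
  (forall x, D x -> f x <= g x)%E ->
  (\int[lebesgue_measure]_(x in D) f x <= \int[lebesgue_measure]_x g x)%E.
Proof.
move=> f0 g0 fg; rewrite integral_mkcond.
have h0 x : (0 <= (f \_ D) x)%E by apply: erestrict_ge0.
rewrite !ge0_integralTE//; apply: le_ereal_sup => _ [k kf <-].
exists k => // x; apply: le_trans (kf x) _.
by rewrite patchE; case: ifPn => // /set_mem; exact: fg.
Qed.

(** The derivative of the curve at the ends of the piece, where it may fail to
    exist, has no effect. *)
Lemma C1_piece_variation (gamma : R -> R[i]) (u v : R) : u < v ->
  C1_on u v gamma ->
  let Y t := complex.Im (gamma t) in
  measurable_fun `]u, v] (derive1 Y) /\
  (`|Y v - Y u|%:E <= \int[lebesgue_measure]_(x in `]u, v]) `|derive1 Y x|%:E)%E.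
Proof.
move=> uv [g [_ [dg ch] ge]] Y.
pose G t := complex.Im (g t); pose h := derive1 G.
have YG t : u <= t <= v -> Y t = G t by move=> /ge gE; rewrite /Y gE.
have Yh x : x \in `]u, v[ -> derive1 Y x = h x.
  move=> xuv; rewrite /h !derive1E; apply: near_eq_derive.
  near=> t; apply: YG.
  have : t \in `]u, v[ by near: t; exact: near_in_itvoo.
  by rewrite in_itv /= => /andP[? ?]; rewrite !ltW.
have mh D : measurable_fun D h.
  by apply: measurable_funTS; exact: continuous_measurable_fun.
have moo : measurable_fun `]u, v[ (derive1 Y).
  apply: (eq_measurable_fun h); last exact: mh.
  by move=> x; rewrite inE /= => /Yh.
have moc : measurable_fun `]u, v] (derive1 Y).
  exact/measurable_fun_itv_bndo_bndcP.
split => //.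
have cG : continuous G by move=> x; apply: differentiable_continuous; apply/derivable1_diffP; exact: dg.
have FTC : (\int[lebesgue_measure]_(x in `[u, v]) (h x)%:E = (G v)%:E - (G u)%:E)%E.
  have cGu : G x @[x --> u^'+] --> G u by apply: cvg_at_right_filter; exact: cG.
  have cGv : G x @[x --> v^'-] --> G v by apply: cvg_at_left_filter; exact: cG.
  apply: (@continuous_FTC2 R h G u v uv).
  - exact: continuous_subspaceT.
  - by split=> [x _| |]; [exact: dg | exact: cGu | exact: cGv].
  - by move=> x _.
rewrite -integral_itv_bndo_bndc; last first.
  by apply/measurable_EFinP; apply: measurableT_comp.
have -> : (\int[lebesgue_measure]_(x in `]u, v[) `|derive1 Y x|%:E
  = \int[lebesgue_measure]_(x in `]u, v[) `|h x|%:E)%E.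
  by apply: eq_integral => x; rewrite inE /= => /Yh ->.
rewrite -(@integral_itv_bndoo _ u v _ true false); last first.
  by apply/measurable_EFinP; apply: measurableT_comp => //; exact: mh.
have -> : `|Y v - Y u|%:E = `|\int[lebesgue_measure]_(x in `[u, v]) (h x)%:E|%E.
  by rewrite FTC !YG ?lexx ?(ltW uv).
apply: (@le_abse_integral _ _ R lebesgue_measure `[u, v] (fun x => (h x)%:E)) => //.
by apply/measurable_EFinP; exact: mh.
Unshelve. all: by end_near. Qed.


End CurveIntegrals.

(** * Divergence along rays *)

Section Curves.
Context {R : realType}.

Lemma piecewise_variation (gamma : R -> R[i]) (u v : R) : u < v ->
  piecewise_smooth gamma ->
  let Y t := complex.Im (gamma t) in
  measurable_fun `]u, v] (derive1 Y) /\
  (`|Y v - Y u|%:E <= \int[lebesgue_measure]_(x in `]u, v]) `|derive1 Y x|%:E)%E.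
Proof.
move=> uv /(_ u v uv)[k [t [<- <- pieces]]] Y.
suff : forall i, (i <= k)%N -> t 0%N <= t i /\
    (measurable_fun `]t 0%N, t i] (derive1 Y) /\
    (`|Y (t i) - Y (t 0%N)|%:E
      <= \int[lebesgue_measure]_(x in `]t 0%N, t i]) `|derive1 Y x|%:E)%E).
  by move=> /(_ k (leqnn k))[].
elim=> [_|i IH ik].
  split => //; have -> : `]t 0%N, t 0%N]%classic = set0 :> set R.
    by apply/seteqP; split => // x /=; rewrite in_itv /= => /andP[/lt_le_trans/[apply]]; rewrite ltxx.
  split; first exact: measurable_fun_set0.
  by rewrite integral_set0 subrr normr0.
have [t0i [mi Bi]] := IH (ltnW ik).
have [ti /(C1_piece_variation _ _ _ ti)[mi1 Bi1]] := pieces i ik.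
split; first exact: le_trans (ltW ti).
have U : `]t 0%N, t i.+1]%classic = `]t 0%N, t i] `|` `]t i, t i.+1] :> set R.
  by rewrite -itv_bndbnd_setU// ?bnd_simp// ltW.
have mU : measurable_fun `]t 0%N, t i.+1] (derive1 Y).
  by rewrite U; apply/measurable_funU.
split => //; rewrite U ge0_integral_setU//=.
- apply: (@le_trans _ _ (`|Y (t i.+1) - Y (t i)| + `|Y (t i) - Y (t 0%N)|)%:E).
    by rewrite lee_fin (le_trans _ (ler_normD _ _))// addrA subrK.
  by rewrite EFinD addeC leeD.
- by apply/measurable_EFinP; apply: measurableT_comp => //; rewrite -U.
- apply/disj_setPS => x [] /=; rewrite !in_itv /= => /andP[_ xi] /andP[ix _].
  by have := lt_le_trans ix xi; rewrite ltxx.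
Qed.

Lemma weighted_length_ge (gamma : R -> R[i]) (weight : R -> R) (u v : R) :
  u < v -> piecewise_smooth gamma -> (forall t, 0 <= weight t) ->
  (forall t, u < t <= v -> 1 <= weight t) ->
  (`|complex.Im (gamma v) - complex.Im (gamma u)|%:E
    <= \int[lebesgue_measure]_t (weight t * speed gamma t)%:E)%E.
Proof.
move=> uv gps w0 w1; have [_ /le_trans] := piecewise_variation _ _ _ uv gps.
apply; apply: le_integral_nonmeasurable => [x _|x|x].
- by rewrite lee_fin.
- by rewrite lee_fin mulr_ge0// modulus_ge0.
- rewrite /= in_itv /= => xuv; rewrite lee_fin.
  apply: (@le_trans _ _ (1 * speed gamma x)).
    by rewrite mul1r /speed; exact: Im_le_modulus (_ +i* _).
  by apply: ler_wpM2r; [exact: modulus_ge0 | exact: w1].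
Qed.

Lemma continuous_complex_pair :
  continuous ((fun p : R * R => p.1 +i* p.2) : R * R -> R[i]^o).
Proof.
move=> p; apply/cvgrPdist_lt => -[e e'] /=; rewrite ltcE /= => /andP[/eqP -> e0].
have e2 : 0 < e / 2 by rewrite divr_gt0.
have c1 : (fun q : R * R => q.1) @ p --> p.1 by exact: cvg_fst.
have c2 : (fun q : R * R => q.2) @ p --> p.2 by exact: cvg_snd.
move/cvgrPdist_lt : c1 => /(_ _ e2) c1; move/cvgrPdist_lt : c2 => /(_ _ e2) c2.
near=> q; rewrite normc_def -sqr_modulus sqrtr_sqr ger0_norm ?modulus_ge0// ltcR.
apply: (le_lt_trans (modulus_le_ReIm _)).
rewrite ReD ReN ImD ImN /= [e]splitr; apply: ltrD.
  by near: q.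
by near: q.
Unshelve. all: by end_near. Qed.

(** The preimage of a square, a compact set, is bounded. *)
Lemma proper_curve_escape (gamma : R -> R[i]) (B : R) : proper_curve gamma ->
  exists T : R, forall t, T < `|t| -> B < modulus (gamma t).
Proof.
move=> [_ gproper].
pose K : set R[i] := (fun p : R * R => p.1 +i* p.2) @` (`[- B, B] `*` `[- B, B]).
have cK : compact (K : set R[i]^o).
  apply: (@continuous_compact (R * R)%type (R[i]^o)
    (fun p : R * R => p.1 +i* p.2 : R[i]^o)).
    by apply: continuous_subspaceT; exact: continuous_complex_pair.
  by apply: compact_setX; exact: segment_compact.
have bK : bounded_set (gamma @^-1` K) by apply: compact_bounded; exact: gproper.
have [T [_ HT]] := bK.
exists (T + 1) => t Tt; rewrite ltNge; apply/negP => gB.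
have : K (gamma t).
  exists (complex.Re (gamma t), complex.Im (gamma t)); last by case: (gamma t).
  split; rewrite /= in_itv /= -ler_norml (le_trans _ gB)//.
    exact: Re_le_modulus.
  exact: Im_le_modulus.
move=> /(HT (T + 1)); rewrite ltrDl ltr01 => /(_ isT) /=.
by rewrite leNgt Tt.
Qed.

(** [cos^2 theta < 1/2] says that [cos (2 theta) < 0]; the latter is
    [- sin (2 theta - pi / 2)]. *)
Lemma cos_sqr_lt_half (theta : R) : pi / 4 < theta < 3 * pi / 4 ->
  cos theta ^+ 2 < 2^-1.
Proof.
move=> /andP[h1 h2]; have : 0 < sin (theta + theta - pi / 2).
  by apply: sin_gt0_pi; apply/andP; split; lra.
rewrite sinBpihalf cosD; have := cos2Dsin2 theta.
by rewrite -!expr2; lra.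
Qed.

Lemma Re_sqr_ray (w : R[i]) (theta : R) : cos theta ^+ 2 < 2^-1 ->
  exists2 delta : R, 0 < delta & exists r1 : R, forall s, ray w theta s ->
    r1 <= modulus s -> complex.Re (s ^+ 2) <= - delta * modulus s ^+ 2.
Proof.
move=> cth; pose d := 2^-1 - cos theta ^+ 2.
have d0 : 0 < d by rewrite subr_gt0.
have W0 : 0 <= modulus w := modulus_ge0 w.
exists d => //; exists ((4 * d + 3) * modulus w / d) => _ [r [r0 ->]].
set v := polar r theta; set s := w + v.
have vr : modulus v = r by rewrite modulus_polar.
have [W WE] : exists W, modulus w = W by exists (modulus w).
have [S SE] : exists S, modulus s = S by exists (modulus s).
have S0 : 0 <= S by rewrite -SE modulus_ge0.
rewrite WE in W0; rewrite WE SE.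
rewrite ler_pdivrMr// => hS.
have rS : S <= W + r by rewrite -SE -WE -vr modulusD_le.
have Sr : r <= S + W.
  by have := modulusD_le s (- w); rewrite modulusN SE WE /s addrAC subrr add0r vr.
have vE : complex.Re (v ^+ 2) = - 2 * d * r ^+ 2.
  rewrite Re_sqr /= !exprMn /d; have := cos2Dsin2 theta.
  by move=> h; rewrite -[sin theta ^+ 2](addKr (cos theta ^+ 2)) h; field.
have diff : complex.Re (s ^+ 2) - complex.Re (v ^+ 2) <= W * (2 * S + W).
  rewrite -ReN -ReD; apply: (le_trans (ler_norm _)).
  apply: (le_trans (Re_le_modulus _)).
  have -> : s ^+ 2 - v ^+ 2 = w * (s + v) by rewrite /s; ring.
  rewrite modulusM WE; apply: ler_wpM2l => //.
  by apply: (le_trans (modulusD_le _ _)); rewrite SE vr; lra.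
have SW : W <= S.
  rewrite -(ler_pM2r d0); apply: le_trans hS.
  by rewrite mulrC ler_wpM2r//; lra.
have r2 : (S - W) ^+ 2 <= r ^+ 2 by rewrite ler_sqr ?nnegrE//; lra.
have := ler_wpM2l (ltW d0) r2.
have := ler_wpM2l S0 hS; have := ler_wpM2l W0 SW; have := mulr_ge0 (ltW d0) (sqr_ge0 W).
by rewrite vE in diff; move: diff; nra.
Qed.

Lemma ray_Im_ge (w : R[i]) (theta : R) (s : R[i]) : cos theta ^+ 2 < 2^-1 ->
  ray w theta s ->
  (modulus s - modulus w) / 2 - `|complex.Im w| <= `|complex.Im s|.
Proof.
move=> cth [r [r0 ->]]; have := modulusD_le w (polar r theta).
rewrite modulus_polar// => h.
have sth : 2^-1 <= `|sin theta|.
  rewrite -(@ler_pXn2r _ 2) ?nnegrE ?invr_ge0// real_normK ?num_real//.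
  have := cos2Dsin2 theta; rewrite expr2; lra.
have := ler_normD (complex.Im (w + polar r theta)) (- complex.Im w).
rewrite ImD /= addrAC subrr add0r normrM (ger0_norm r0) normrN.
by have := ler_wpM2l r0 sth; lra.
Qed.

(** On the interval [S] the curve stays on one ray, so that its imaginary part
    is unbounded there, and the weighted length is at least the variation of
    the imaginary part. *)
Lemma weighted_length_infinite (gamma : R -> R[i]) (weight : R -> R) (S : set R)
    (T : R) (w : R[i]) (theta : R) :
  piecewise_smooth gamma -> (forall t, 0 <= weight t) ->
  cos theta ^+ 2 < 2^-1 -> is_interval S -> S T ->
  (forall t, S t -> ray w theta (gamma t) /\ 1 <= weight t) ->
  (forall B, exists2 t, S t & B < modulus (gamma t)) ->
  (\int[lebesgue_measure]_t (weight t * speed gamma t)%:E = +oo)%E.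
Proof.
move=> gps w0 cth iS ST HS unb; apply/eqyP => x x0.
pose YT := complex.Im (gamma T).
have [V SV] := unb (Num.max (modulus (gamma T))
  (2 * (x + `|complex.Im w| + `|YT|) + modulus w)).
rewrite gt_max => /andP[VT VB].
have [rV _] := HS V SV; have hV := ray_Im_ge _ _ _ cth rV.
have big : x <= `|complex.Im (gamma V) - YT|.
  have := ler_normD (complex.Im (gamma V) - YT) YT; rewrite subrK.
  by lra.
apply: (@le_trans _ _ `|complex.Im (gamma V) - YT|%:E); first by rewrite lee_fin.
have [TV|VltT|E] := ltgtP T V.
- apply: weighted_length_ge => // t /andP[Tt tV].
  by have [] := HS t (iS _ _ ST SV t _); first by rewrite (ltW Tt).
- rewrite distrC; apply: weighted_length_ge => // t /andP[Vt tT].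
  by have [] := HS t (iS _ _ SV ST t _); first by rewrite (ltW Vt).
- by move: VT; rewrite E ltxx.
Qed.

(** [f] is large at the points [s] of large modulus where [Re (s^2)] is negative
    and comparable to [|s|^2]. *)
Section Divergence.
Variable f : R[i] -> R[i].
Hypothesis f_large : forall delta B : R, 0 < delta ->
  exists r1 : R, forall s, r1 <= modulus s ->
    complex.Re (s ^+ 2) <= - delta * modulus s ^+ 2 -> B <= modulus (f s).

Lemma ray_large (w : R[i]) (theta B : R) : cos theta ^+ 2 < 2^-1 ->
  exists r1 : R, forall s, ray w theta s -> r1 <= modulus s -> B <= modulus (f s).
Proof.
move=> /(Re_sqr_ray w)[d d0 [r1 H1]]; have [r2 H2] := f_large d B d0.
exists (Num.max r1 r2) => s rs; rewrite ge_max => /andP[h1 h2].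
exact: H2 (H1 s rs h1).
Qed.

Lemma ray_end_diverges (gamma : R -> R[i]) (w : R[i]) (theta : R) :
  piecewise_smooth gamma -> proper_curve gamma -> cos theta ^+ 2 < 2^-1 ->
  (\forall t \near +oo, ray w theta (gamma t)) \/
  (\forall t \near -oo, ray w theta (gamma t)) ->
  (\int[lebesgue_measure]_t (modulus (f (gamma t)) * speed gamma t)%:E = +oo)%E.
Proof.
move=> gps gpr cth tail; have [r1 H1] := ray_large w theta 1 cth.
have [T1 HT1] := proper_curve_escape gamma r1 gpr.
case: tail => -[M [_ HM]].
- pose T := `|M| + `|T1| + 1.
  have TM : M < T by rewrite /T; have := ler_norm M; have := normr_ge0 T1; lra.
  have TT1 : T1 < T by rewrite /T; have := ler_norm T1; have := normr_ge0 M; lra.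
  apply: (weighted_length_infinite gamma (fun t => modulus (f (gamma t)))
    `[T, +oo[ T w theta) => //.
  + by move=> t; exact: modulus_ge0.
  + exact: interval_is_interval.
  + by rewrite /= in_itv /= lexx.
  + move=> t /=; rewrite in_itv /= andbT => Tt.
    have rt : ray w theta (gamma t) by apply: HM; exact: lt_le_trans Tt.
    split => //; apply: H1 => //; apply/ltW/HT1.
    by apply: (lt_le_trans TT1); apply: (le_trans Tt); exact: ler_norm.
  + move=> B; have [T2 HT2] := proper_curve_escape gamma B gpr.
    exists (T + `|T2| + 1).
      by rewrite /= in_itv /= andbT; have := normr_ge0 T2; lra.
    apply: HT2; apply: lt_le_trans (ler_norm _).
    have := ler_norm T2; have := normr_ge0 M; have := normr_ge0 T1.
    by rewrite /T; lra.
- pose T := - (`|M| + `|T1| + 1).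
  have TM : T < M by rewrite /T; have := ler_norm (- M); rewrite normrN; have := normr_ge0 T1; lra.
  have TT1 : T1 < - T by rewrite /T; have := ler_norm T1; have := normr_ge0 M; lra.
  apply: (weighted_length_infinite gamma (fun t => modulus (f (gamma t)))
    `]-oo, T] T w theta) => //.
  + by move=> t; exact: modulus_ge0.
  + exact: interval_is_interval.
  + by rewrite /= in_itv /= lexx.
  + move=> t /=; rewrite in_itv /= => Tt.
    have rt : ray w theta (gamma t) by apply: HM; exact: le_lt_trans TM.
    split => //; apply: H1 => //; apply/ltW/HT1.
    apply: (lt_le_trans TT1); rewrite -normrN; apply: le_trans (ler_norm _).
    by rewrite lerN2.
  + move=> B; have [T2 HT2] := proper_curve_escape gamma B gpr.
    exists (T - `|T2| - 1).
      by rewrite /= in_itv /=; have := normr_ge0 T2; lra.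
    apply: HT2; rewrite -normrN; apply: lt_le_trans (ler_norm _).
    have := ler_norm T2; have := normr_ge0 M; have := normr_ge0 T1.
    by rewrite /T; lra.
Qed.

Lemma vertical_line_large (c B : R) :
  exists T : R, forall t, T <= t -> B <= modulus (f (c +i* t)).
Proof.
have cth : cos (pi / 2 : R) ^+ 2 < 2^-1 by rewrite cos_pihalf expr0n /= invr_gt0.
have [r1 H] := ray_large c%:C (pi / 2) B cth.
exists (Num.max r1 0) => t; rewrite ge_max => /andP[rt t0].
apply: H; last first.
  apply: le_trans (Im_le_modulus _); apply: (le_trans rt).
  exact: ler_norm.
exists t; split => //; rewrite /polar cos_pihalf sin_pihalf mulr0 mulr1.
by apply/eqP; rewrite eq_complex /= addr0 add0r !eqxx.
Qed.

End Divergence.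
End Curves.

(** * Mellin transforms and the conclusion *)

Section Mellin.
Context {R : realType}.

Let modulus_integrable (D : set R) (g : R -> R[i]) : measurable (D : set (measurableTypeR R)) ->
  cintegrable D g -> lebesgue_measure.-integrable D
    (EFin \o (fun x => `|complex.Re (g x)| + `|complex.Im (g x)|)).
Proof.
move=> mD [iR iI].
by have := integrableD mD (integrable_abse iR) (integrable_abse iI); apply: eq_integrable.
Qed.

Lemma cintegral_le (D : set R) (g : R -> R[i]) (h : R -> R) : measurable (D : set (measurableTypeR R)) ->
  cintegrable D g -> lebesgue_measure.-integrable D (EFin \o h) ->
  (forall x, D x -> modulus (g x) <= h x) ->
  modulus (cintegral D g) <= 2 * \int[lebesgue_measure]_(x in D) h x.
Proof.
move=> mD [iR iI] ih gh; apply: (le_trans (modulus_le_ReIm _)) => /=.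
rewrite (_ : 2 * _ = \int[lebesgue_measure]_(x in D) h x
  + \int[lebesgue_measure]_(x in D) h x); last by ring.
apply: lerD; apply: (le_trans (le_normr_Rintegral mD _)) => //;
  apply: le_Rintegral => //.
- exact: integrable_abse iR.
- by move=> x Dx; apply: le_trans (gh x Dx); exact: Re_le_modulus.
- exact: integrable_abse iI.
- by move=> x Dx; apply: le_trans (gh x Dx); exact: Im_le_modulus.
Qed.

(** Along a vertical line the modulus of the Mellin integrand does not depend
    on the imaginary part. *)
Lemma mellin_transform_bounded (f : R -> R[i]) (c t0 : R) (v0 : R[i]) :
  is_mellin_transform f (c +i* t0) v0 ->
  exists B : R, forall (t : R) (v : R[i]),
    is_mellin_transform f (c +i* t) v -> modulus v <= B.
Proof.
move=> [i0 _]; have m0 : measurable (`]0, +oo[%classic : set (measurableTypeR R)) by [].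
have ih := modulus_integrable _ _ m0 i0.
eexists => t v [it ->]; apply: (cintegral_le _ _ _ m0 it ih) => x _ /=.
apply: le_trans (modulus_le_ReIm _); rewrite !modulusM !modulus_cexp.
by rewrite !ReM_real.
Qed.

Lemma cintegrable_not_large (g : R -> R[i]) (T : R) :
  cintegrable setT g -> ~ (forall t, T <= t -> 1 <= modulus (g t)).
Proof.
move=> /(modulus_integrable _ _ measurableT)/integrableP[_ fin] large.
have inf : (\int[lebesgue_measure]_(x in `[T, +oo[) cst 1 x = +oo :> \bar R)%E.
  by rewrite integral_cst//= mul1e lebesgue_measure_itv /= ltry.
suff : (+oo < +oo :> \bar R)%E by rewrite ltxx.
rewrite -{1}inf; apply: le_lt_trans fin.
apply: le_integral_nonmeasurable => // x; rewrite /= in_itv /= andbT => Tx.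
rewrite lee_fin ger0_norm ?addr_ge0//; apply: (le_trans (large x Tx)).
exact: modulus_le_ReIm.
Qed.

(** The poles have the imaginary parts of the [a j] and [b j]. *)
Lemma vertical_line_avoids_poles (tau c : R) (m n p q : nat)
    (a : 'I_p -> R[i]) (b : 'I_q -> R[i]) :
  exists T : R, forall t, T <= t -> ~ poles tau m n a b (c +i* t).
Proof.
exists (\sum_j `|complex.Im (a j)| + \sum_j `|complex.Im (b j)| + 1) => t.
have a0 : 0 <= \sum_j `|complex.Im (a j)| by exact: sumr_ge0.
have b0 : 0 <= \sum_j `|complex.Im (b j)| by exact: sumr_ge0.
have aj j : complex.Im (a j) <= \sum_j `|complex.Im (a j)|.
  by apply: (le_trans (ler_norm _)); rewrite (bigD1 j)//= lerDl sumr_ge0.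
have bj j : complex.Im (b j) <= \sum_j `|complex.Im (b j)|.
  by apply: (le_trans (ler_norm _)); rewrite (bigD1 j)//= lerDl sumr_ge0.
have Imnat (k : nat) : complex.Im (k%:R : R[i]) = 0.
  by rewrite -(rmorph_nat (real_complex R)).
have Imnatr (k : nat) (x : R) : complex.Im (k%:R * x%:C : R[i]) = 0.
  by rewrite -(rmorph_nat (real_complex R)) -rmorphM.
move=> tT [[j [l [k [_ /(congr1 (@complex.Im R))]]]]|].
  by rewrite !ImD Imnat Imnatr !addr0 /= => tE; have := aj j; lra.
move=> [j [l [k [_ _ _ /(congr1 (@complex.Im R))]]]].
by rewrite !ImD !ImN Imnat Imnatr oppr0 !addr0 /= => tE; have := bj j; lra.
Qed.

End Mellin.

Theorem theorem9p1 (R : realType) (tau : R) (m n p q : nat)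
    (a : 'I_p -> R[i]) (b : 'I_q -> R[i]) (alpha : R[i]) (rho omega : R)
    (htau : 0 < tau) (hmq : (m <= q)%N) (hnp : (n <= p)%N)
    (hsep : pole_gap tau m n a b) (hrho : 0 < rho)
    (hN : indexN m n p q < 0) :
  let F := phi tau m n a b alpha in
  let logz := log_point rho omega in
  (forall theta : R, theta = pi / 2 \/ theta = - (pi / 2) ->
     (exists eps : R -> R,
        eps r @[r --> +oo] --> 0 /\
        \forall r \near +oo,
          modulus (twisted F logz (polar r theta))
          = expR (`|indexN m n p q|%:~R / (2 * tau)
                  * (r ^+ 2 * ln r) * (1 + eps r))) /\
     modulus (twisted F logz (polar r theta)) @[r --> +oo] --> +oo) /\
  (forall (gamma : R -> R[i]) (thm thp : R),
     condA1 (poles tau m n a b) gamma -> condA2 gamma thm thp ->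
     pi / 4 < thp < 3 * pi / 4 \/ pi / 4 < - thm < 3 * pi / 4 ->
     ~ condA4 F logz gamma) /\
  (forall (c : R) (gamma : R -> R[i]) (thm thp : R),
     range gamma = vertical_line c ->
     ~ admissible tau m n a b alpha logz gamma thm thp) /\
  (forall (c1 c2 : R) (f : R -> R[i]), c1 < c2 ->
     ~ (forall s : R[i], c1 < complex.Re s < c2 -> ~ poles tau m n a b s ->
          is_mellin_transform f s (F s)) /\
     (forall c x : R, c1 < c < c2 -> 0 < x ->
        ~ is_inverse_mellin F c x (f x))).
Proof.
move=> F logz.
have N0 : (indexN m n p q)%:~R < 0 :> R by rewrite ltrz0.
have growth lz := log_growth_twisted tau htau m n p q a b alpha lz hmq hnp.
have large lz := log_growth_large tau htau _ _ N0 (growth lz).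
have absN : `|indexN m n p q|%:~R = - (indexN m n p q)%:~R :> R.
  by rewrite ltr0_norm// rmorphN.
have diverges gamma w theta : condA1 (poles tau m n a b) gamma ->
    cos theta ^+ 2 < 2^-1 ->
    (\forall t \near +oo, ray w theta (gamma t)) \/
    (\forall t \near -oo, ray w theta (gamma t)) ->
    ~ condA4 F logz gamma.
  move=> [_ gps gpr _] cth tail; rewrite /condA4.
  by rewrite (ray_end_diverges _ (large logz) _ _ _ gps gpr cth tail) ltxx.
split; [|split; [|split]].
- move=> theta th; split; last exact: (log_growth_vertical_pinfty tau htau _ _ N0 (growth logz)).
  by rewrite absN; exact: (log_growth_vertical tau htau _ _ N0 (growth logz)).
- move=> gamma thm thp A1 [_ _ [center [wm [wp [r [_ rm rp]]]]]] [hp|hm].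
  + by apply: (diverges _ wp thp A1); [exact: cos_sqr_lt_half | left].
  + apply: (diverges _ wm thm A1); last by right.
    by rewrite -cosN; exact: cos_sqr_lt_half.
- move=> c gamma thm thp line [A1 [_ _ [center [wm [wp [r [_ _ rp]]]]]] _].
  apply: (diverges _ wp thp A1 _ (or_introl rp)).
  have [M [_ HM]] := rp.
  have [r1 [_ E1]] := HM (M + 1) (ltr_pwDr ltr01 (lexx M)).
  have [r2 [_ E2]] : ray wp thp (gamma (M + 2)) by apply: HM; lra.
  have Rec t : complex.Re (gamma t) = c.
    by have : range gamma (gamma t) by [exists t]; rewrite line.
  have [inj _ _ _] := A1.
  (* Two distinct points of the end ray lie on the line, so that the ray is
     vertical. *)
  have r12 : r1 - r2 != 0.
    rewrite subr_eq0; apply/eqP => r12; rewrite -r12 -E1 in E2.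
    by have := inj _ _ E2; lra.
  have := Rec (M + 1); rewrite -(Rec (M + 2)) E1 E2 !ReD /= => h.
  have /eqP : (r1 - r2) * cos thp = 0 by rewrite mulrBl; lra.
  by rewrite mulf_eq0 (negbTE r12) => /eqP ->; rewrite expr0n /= invr_gt0.
- move=> c1 c2 f c12; split.
  + pose c := (c1 + c2) / 2 => mellin.
    have [T0 HT0] := vertical_line_avoids_poles tau c m n p q a b.
    have mc t : T0 <= t -> is_mellin_transform f (c +i* t) (F (c +i* t)).
      move=> /HT0; apply: mellin; rewrite /c /=; lra.
    (* [B] bounds [F] at all the large heights of the line, where [F] is
       unbounded. *)
    have [B HB] := mellin_transform_bounded f c T0 _ (mc T0 (lexx T0)).
    have [T1 HT1] := vertical_line_large _ (large 0) c (B + 1).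
    have := HB _ _ (mc (Num.max T0 T1) _); rewrite le_max lexx => /(_ isT).
    have := HT1 (Num.max T0 T1); rewrite le_max lexx orbT => /(_ isT).
    rewrite /twisted mulr0 modulusM modulus_cexp expR0 mulr1 -/F.
    by lra.
  + move=> c x _ _ [ig _].
    have [T HT] := vertical_line_large _ (large (ln x)%:C) c 1.
    exact: cintegrable_not_large ig HT.
Qed.
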